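(* Let $G=(\mathbf Z_2\wr\mathbf Z)^3$. Then the problem Kernel-over-$\mathbb Z[G]$ is undecidable: there is no algorithm which, given as input a matrix $M\in M_k(\mathbb Z[G])$ for some $k$, always halts and correctly decides whether $\ker M=\{0\}$, where $M$ is considered as an operator $l^2(G)^k\to l^2(G)^k$.
   Context: $\mathbf Z$ is the infinite cyclic group, $\mathbf Z_2$ the cyclic group of order $2$, and $\mathbf Z_2\wr\mathbf Z=\left(\bigoplus_{\mathbf Z}\mathbf Z_2\right)\rtimes\mathbf Z$, where $\mathbf Z$ acts by shifting coordinates; the exponent $3$ denotes the direct product of three copies. $\mathbb Z[G]$ is the integral group ring and $M_k(\mathbb Z[G])$ the ring of $k\times k$ matrices over it. $l^2(G)$ is the Hilbert space with orthonormal basis $(\zeta_g)_{g\in G}$; $\mathbb Z[G]$ acts on it by bounded operators via $g\cdot\zeta_h=\zeta_{gh}$, and $M_k(\mathbb Z[G])$ acts on $l^2(G)^k$ accordingly. Elements of $\mathbb Z[G]$ are given to the algorithm as finite formal integer combinations of words in a fixed finite generating set of $G$. ''Undecidable'' has the usual meaning from Turing computability. *)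

(* Defs.v *)
From HB Require Import structures.
From mathcomp Require Import all_boot all_order all_algebra.
From mathcomp Require Import finmap.
From mathcomp Require Import boolp classical_sets functions reals ereal esum.
From mathcomp Require Import complex lra.
From mathcomp Require Import -(notations) monalg.

Set Implicit Arguments.
Unset Strict Implicit.
Unset Printing Implicit Defensive.

Import Order.TTheory GRing.Theory Num.Theory.
Local Open Scope ring_scope.

(* The notations of monalg cannot be imported together with those of
   mathcomp-analysis, hence the import filter above and the copies below. *)
Notation "{ 'malg' G [ K ] }" := (@monalg.malg K G)
  (at level 0, K, G at level 2, format "{ 'malg'  G [ K ] }") : type_scope.
Notation "g @_ k" := (monalg.mcoeff k g)
  (at level 3, k at level 2, left associativity, format "g @_ k") : ring_scope.
Notation "<< z *g k >>" := (monalg.mkmalgU k z)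
  (at level 0, format "<< z *g k >>") : ring_scope.

Section Shift.

(* {malg A[K]} is the type of finitely supported functions K -> A, so that
   {malg 'Z_2[int]} is the direct sum of copies of Z/2 indexed by Z, and
   {malg int[G]} (below) is the additive group of the group ring Z[G]. *)
Definition shift (n : int) (f : {malg 'Z_2[int]}) : {malg 'Z_2[int]} :=
  monalg.mkmalg
    [fsfun i in [fset (j + n)%R | j in monalg.msupp f]%fset => f@_(i - n)].

Lemma shiftE n f i : (shift n f)@_i = f@_(i - n).
Proof.
rewrite monalg.mcoeffE; case: ifPn => // nfi.
apply/esym/monalg.mcoeff_outdom; apply: contra nfi => fi.
by apply/imfsetP; exists (i - n) => //=; rewrite subrK.
Qed.

Lemma shift0 f : shift 0 f = f.
Proof. by apply/monalg.malgP => i; rewrite shiftE subr0. Qed.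

Lemma shiftD m n f : shift (m + n) f = shift m (shift n f).
Proof. by apply/monalg.malgP => i; rewrite !shiftE opprD addrA. Qed.

Lemma shift_add n f g : shift n (f + g) = shift n f + shift n g.
Proof.
by apply/monalg.malgP => i; rewrite monalg.mcoeffD !shiftE monalg.mcoeffD.
Qed.

End Shift.

Definition lamplighter : Type := ({malg 'Z_2[int]} * int)%type.

HB.instance Definition _ := Choice.on lamplighter.

Section LamplighterGroup.
Implicit Types x y z : lamplighter.

Definition lone : lamplighter := (0, 0).
Definition lmul x y : lamplighter := (x.1 + shift x.2 y.1, x.2 + y.2).
Definition linv x : lamplighter := (- shift (- x.2) x.1, - x.2).

Lemma lmulA : associative lmul.
Proof.
by move=> x y z; rewrite /lmul /= shift_add -shiftD !addrA.
Qed.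

Lemma lmul1 : left_id lone lmul.
Proof. by case=> f n; rewrite /lmul /= shift0 !add0r. Qed.

Lemma lmul1r : right_id lone lmul.
Proof.
case=> f n; rewrite /lmul /= addr0; congr pair.
by apply/monalg.malgP => i; rewrite monalg.mcoeffD shiftE !monalg.mcoeff0 addr0.
Qed.

Lemma lmulV : left_inverse lone linv lmul.
Proof. by case=> f n; rewrite /lmul /linv /= !addNr. Qed.

Lemma lmulrV : right_inverse lone linv lmul.
Proof.
case=> f n; rewrite /lmul /linv /= subrr; congr pair.
apply/monalg.malgP => i.
by rewrite monalg.mcoeffD shiftE monalg.mcoeffN shiftE opprK subrK subrr monalg.mcoeff0.
Qed.

End LamplighterGroup.

HB.instance Definition _ :=
  isGroup.Build lamplighter lmulA lmul1 lmul1r lmulV lmulrV.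

Definition lamplighter3 : groupType :=
  (lamplighter * lamplighter * lamplighter)%type.

Section GroupRing.
Variables (R : realType) (G : groupType).
Implicit Types (a : {malg int[G]}) (xi eta : G -> R[i]).

Local Notation normc := ComplexField.Normc.normc.

(* The complex Hilbert space l^2(G): square-summable families G -> R[i]. *)
Definition ell2 : set (G -> R[i]) :=
  [set xi | summable [set: G] (fun g => (normc (xi g) ^+ 2)%:E)].

Definition zeta (h : G) : G -> R[i] := fun x => (x == h)%:R.

(* (a xi)(h) = sum_g a_g xi(g^-1 h), i.e. the extension to l^2(G) of
   g . zeta_h = zeta_(g h); see gract_zeta. *)
Definition gract a xi : G -> R[i] :=
  fun h => \sum_(g <- monalg.msupp a) (a@_g)%:~R * xi (g^-1 * h)%g.

(* Matrices act on the left on columns; mxact_ell2 shows that l^2(G)^k is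
   preserved. *)
Definition mxact k (M : 'M[{malg int[G]}]_k) (xi : 'I_k -> G -> R[i]) :
    'I_k -> G -> R[i] :=
  fun i h => \sum_(j < k) gract (M i j) (xi j) h.

Definition l2kernel k (M : 'M[{malg int[G]}]_k) : set ('I_k -> G -> R[i]) :=
  [set xi | (forall j, ell2 (xi j)) /\ mxact M xi = (fun _ _ => 0)].

Lemma gract_zeta g h : gract << 1 *g g >> (zeta h) =1 zeta (g * h)%g.
Proof.
move=> x; rewrite /gract monalg.msuppU oner_eq0 big_seq_fset1 monalg.mcoeffUU.
by rewrite mul1r /zeta (can2_eq (mulVKg g) (mulKg g)).
Qed.

Lemma ell2_le xi (f : G -> R) :
  (forall g, normc (xi g) ^+ 2 <= f g) ->
  summable [set: G] (fun g => (f g)%:E) -> ell2 xi.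
Proof.
move=> le_f; apply: le_lt_trans; apply: le_esum => g _.
by rewrite !abse_EFin lee_fin !ger0_norm ?sqr_ge0 // (le_trans _ (le_f g))
  ?sqr_ge0.
Qed.

Lemma ell2_0 : ell2 (fun _ => 0).
Proof.
rewrite /ell2 /= /summable esum1 // => g _.
by rewrite /= expr0n /= addr0 sqrtr0 expr0n /= normr0.
Qed.

Lemma ell2D xi eta : ell2 xi -> ell2 eta -> ell2 (fun g => xi g + eta g).
Proof.
move=> hx he; have h2 := summableD (summableD hx hx) (summableD he he).
apply: (ell2_le _ h2) => g.
have := le_normcD (xi g) (eta g).
set u := normc (xi g); set v := normc (eta g); set w := normc _ => le_w.
have w0 : 0 <= w by rewrite /w; case: (_ + _) => ? ?; exact: sqrtr_ge0.
apply: (le_trans (_ : _ <= (u + v) ^+ 2)).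
  by rewrite ler_pXn2r ?nnegrE // (le_trans w0).
have := sqr_ge0 (u - v); rewrite sqrrB sqrrD.
move: (u ^+ 2) (v ^+ 2) (u * v) => a b c; lra.
Qed.

Lemma ell2N xi : ell2 xi -> ell2 (fun g => - xi g).
Proof.
apply: ell2_le => g; rewrite le_eqVlt; apply/orP; left; apply/eqP; congr (_ ^+ 2).
by case: (xi g) => x y /=; rewrite !sqrrN.
Qed.

Lemma ell2Mz xi (z : int) : ell2 xi -> ell2 (fun g => z%:~R * xi g).
Proof.
move=> hx.
have hn (n : nat) : ell2 (fun g => n%:R * xi g).
  elim: n => [|n IHn].
    rewrite [X in ell2 X](_ : _ = fun _ => 0); first exact: ell2_0.
    by apply/funext => g; rewrite mul0r.
  rewrite [X in ell2 X](_ : _ = fun g => xi g + n%:R * xi g); first exact: ell2D.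
  by apply/funext => g; rewrite -natr1 mulrDl mul1r addrC.
case: z => n; first exact: hn.
rewrite [X in ell2 X](_ : _ = fun g => - (n.+1%:R * xi g)).
  exact/ell2N/hn.
by apply/funext => g; rewrite NegzE mulrNz mulNr.
Qed.

Lemma ell2_translate xi g : ell2 xi -> ell2 (fun h => xi (g^-1 * h)%g).
Proof.
rewrite /ell2 /= /summable.
rewrite [X in (X < _)%E -> _](reindex_esum [set: G] [set: G]
  (fun h => (g^-1 * h)%g)) //.
split => // [x y _ _|x _]; first exact: mulgI.
by exists (g * x)%g => //; rewrite mulKg.
Qed.

Lemma ell2_sum (I : Type) (r : seq I) (F : I -> G -> R[i]) :
  (forall i, ell2 (F i)) -> ell2 (fun g => \sum_(i <- r) F i g).
Proof.
move=> hF; elim: r => [|i r IHr].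
  rewrite [X in ell2 X](_ : _ = fun _ => 0); first exact: ell2_0.
  by apply/funext => g; rewrite big_nil.
rewrite [X in ell2 X](_ : _ = fun g => F i g + \sum_(j <- r) F j g).
  exact: ell2D.
by apply/funext => g; rewrite big_cons.
Qed.

Lemma mxact_ell2 k (M : 'M[{malg int[G]}]_k)
    (xi : 'I_k -> G -> R[i]) :
  (forall j, ell2 (xi j)) -> forall i, ell2 (mxact M xi i).
Proof.
move=> hxi i; apply: ell2_sum => j; apply: ell2_sum => g.
exact/ell2Mz/ell2_translate.
Qed.

End GroupRing.

Arguments ell2 : clear implicits.
Arguments l2kernel R {G k} M.

Section Presentation.
Variables (G : groupType) (n : nat) (s : 'I_n -> G).

(* (i, false) stands for the generator s i and (i, true) for its inverse. *)
Definition letter : Type := ('I_n * bool)%type.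
Definition word : Type := seq letter.
(* A finite formal integer combination of words; repetitions of a word and
   zero coefficients are allowed. *)
Definition formal : Type := seq (int * word).
Definition presented_mx : Type := {k : nat & 'M[formal]_k.+1}.

Definition eval_letter (l : letter) : G := if l.2 then (s l.1)^-1%g else s l.1.
Definition eval_word (w : word) : G := (\prod_(l <- w) eval_letter l)%g.
Definition eval_formal (c : formal) : {malg int[G]} :=
  \sum_(t <- c) << t.1 *g eval_word t.2 >>.
Definition eval_mx k (M : 'M[formal]_k) : 'M[{malg int[G]}]_k :=
  map_mx eval_formal M.

Definition generates : Prop := forall g : G, exists w : word, eval_word w = g.

End Presentation.

Definition trivial_l2kernel (R : realType) (G : groupType) n (s : 'I_n -> G)
    (M : presented_mx n) : Prop :=
  l2kernel R (eval_mx s (tagged M)) =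
    [set ((fun _ _ => 0) : 'I_(tag M).+1 -> G -> R[i])]%classic.

Arguments trivial_l2kernel R {G n} s M.

Inductive mark := Row | Entry | Term | Minus | Tick.

Definition mark_code (m : mark) : 'I_5 :=
  match m with
  | Row => @Ordinal 5 0 isT | Entry => @Ordinal 5 1 isT
  | Term => @Ordinal 5 2 isT | Minus => @Ordinal 5 3 isT
  | Tick => @Ordinal 5 4 isT
  end.
Definition mark_decode (i : 'I_5) : mark :=
  nth Tick [:: Row; Entry; Term; Minus; Tick] i.
Lemma mark_codeK : cancel mark_code mark_decode.
Proof. by case. Qed.
HB.instance Definition _ := Finite.copy mark (can_type mark_codeK).

Section Encoding.
Variable n : nat.

Definition symbol : finType := ('I_n * bool + mark)%type.

(* Integers are written in unary. Each row, entry and term is preceded by its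
   mark, so that the encoding is injective (encode_mx_inj); the size of the
   matrix is the number of Row marks. *)
Definition encode_int (z : int) : seq symbol :=
  (if z < 0 then [:: inr Minus] else [::]) ++ nseq `|z|%N (inr Tick).
Definition encode_term (t : int * word n) : seq symbol :=
  encode_int t.1 ++ [seq inl l | l <- t.2].
Definition encode_formal (c : formal n) : seq symbol :=
  flatten [seq inr Term :: encode_term t | t <- c].
Definition encode_row (r : seq (formal n)) : seq symbol :=
  flatten [seq inr Entry :: encode_formal c | c <- r].
Definition encode_rows (rs : seq (seq (formal n))) : seq symbol :=
  flatten [seq inr Row :: encode_row r | r <- rs].
Definition mx_rows k (M : 'M[formal n]_k) : seq (seq (formal n)) :=
  [seq [seq M i j | j <- enum 'I_k] | i <- enum 'I_k].
Definition encode_mx (M : presented_mx n) : seq symbol :=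
  encode_rows (mx_rows (tagged M)).

Fact flatten_mark_inj (A : Type) (T : eqType) (m : T) (f : A -> seq T) :
  injective f -> (forall x, m \notin f x) ->
  injective (fun s => flatten [seq m :: f x | x <- s]).
Proof.
move=> f_inj f_m; elim=> [|x s IHs] [|y t] //= [].
have idx z u :
    index m (f z ++ flatten [seq m :: f x | x <- u]) = size (f z).
  rewrite index_cat (negPf (f_m z)); case: u => [|u0 u] /=; rewrite ?eqxx addn0 //.
move=> e; have sz : size (f x) = size (f y) by rewrite -(idx x s) -(idx y t) e.
move/eqP: e; rewrite eqseq_cat // => /andP[/eqP/f_inj -> /eqP e].
by rewrite (IHs t e).
Qed.

Fact notin_flatten_mark (A : Type) (T : eqType) (m m' : T) (f : A -> seq T) s :
  m != m' -> (forall x, m \notin f x) -> m \notin flatten [seq m' :: f x | x <- s].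
Proof.
move=> mm' fm; elim: s => //= x s IHs.
by rewrite inE mem_cat !negb_or mm' fm IHs.
Qed.

Fact encode_term_notin (m : mark) t :
  m \notin [:: Minus; Tick] -> inr m \notin encode_term t.
Proof.
rewrite !inE negb_or => /andP[m1 m2]; rewrite !mem_cat !negb_or mem_nseq.
rewrite -andbA; apply/and3P; split.
- by case: ifP; rewrite ?inE.
- by rewrite negb_and; apply/orP; right.
- by apply/mapP => -[].
Qed.

Fact encode_term_inj : injective encode_term.
Proof.
move=> [z w] [z' w'] e.
have ez u v : [seq x <- encode_term (u, v) | if x is inr _ then true else false]
    = encode_int u.
  rewrite filter_cat [X in _ ++ X](_ : _ = [::]) ?cats0; last by elim: v.
  by rewrite /encode_int; case: ifP => _ /=; elim: `|u|%N => //= m ih;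
    move: ih => [->].
have ew u v : pmap (fun x : symbol => if x is inl l then Some l else None)
    (encode_term (u, v)) = v.
  rewrite pmap_cat [X in X ++ _](_ : _ = [::]); last first.
    by rewrite /encode_int; case: ifP => _ /=; elim: `|u|%N.
  by elim: v => //= l v ->.
have -> : w = w' by rewrite -(ew z w) -(ew z' w') e.
congr pair; have := ez z w; rewrite e ez => {e ez ew} e.
have := congr1 (count_mem (inr Tick)) e.
have := congr1 (has (pred1 (inr Minus))) e.
have tm : (inr Tick == inr Minus :> symbol) = false by apply/eqP.
have mt : (inr Minus == inr Tick :> symbol) = false by apply/eqP.
rewrite /encode_int !has_cat !count_cat !has_nseq !count_nseq /= ?tm ?eqxx.
rewrite ?andbF ?orbF ?mul1n.
case: (ltrP z' 0) => hz'; case: (ltrP z 0) => hz; rewrite /= ?eqxx ?mt ?add0n // => _ e1.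
  by rewrite -[z]opprK -[z']opprK -(ltr0_norm hz) -(ltr0_norm hz') -!abszE e1.
by rewrite -(ger0_norm hz) -(ger0_norm hz') -!abszE e1.
Qed.

Fact encode_rows_inj : injective encode_rows.
Proof.
have hf m c : m \notin [:: Minus; Tick] -> m != Term -> inr m \notin encode_formal c.
  by move=> m1 m2; apply: notin_flatten_mark => // t; apply: encode_term_notin.
apply: flatten_mark_inj => [|r]; last first.
  by apply: notin_flatten_mark => // c; apply: hf.
apply: flatten_mark_inj => [|c]; last exact: hf.
apply: flatten_mark_inj => [|t]; first exact: encode_term_inj.
exact: encode_term_notin.
Qed.

Fact encode_mx_inj : injective encode_mx.
Proof.
move=> [k M] [l N] /encode_rows_inj /= e.
have kl : k = l.
  by have := congr1 size e; rewrite /mx_rows 2!size_map !size_enum_ord => -[].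
case: _ / kl in N e *; congr existT; apply/matrixP => i j.
have nthE (A : 'M[formal n]_k.+1) :
    nth [::] (nth [::] (mx_rows A) i) j = A i j.
  rewrite (nth_map ord0) ?size_enum_ord // (nth_map ord0) ?size_enum_ord //.
  by rewrite !nth_ord_enum.
by rewrite -[LHS]nthE -[RHS]nthE e.
Qed.

End Encoding.

Inductive move := Left | Stay | Right.

Definition move_int (d : move) : int :=
  match d with Left => -1 | Stay => 0 | Right => 1 end.

Section Turing.
Variable Sigma : finType.

(* Deterministic machines with one two-way infinite tape and input alphabet
   Sigma. The tape symbols are the blank None, the input symbols
   Some (inl a) and finitely many auxiliary symbols Some (inr b). The machine
   halts, with answer b, on entering a state whose verdict is Some b. *)
Record TM := {
  state : finType;
  aux : finType;
  start : state;
  verdict : state -> option bool;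
  trans : state -> option (Sigma + aux) ->
    state * option (Sigma + aux) * move
}.

Section Run.
Variable T : TM.

Definition tape_symbol : Type := option (Sigma + aux T).
Record config := Config {
  cstate : state T;
  chead : int;
  ctape : int -> tape_symbol
}.

Definition step (c : config) : config :=
  let: (q, a, d) := trans (cstate c) (ctape c (chead c)) in
  Config q (chead c + move_int d)
    (fun i => if i == chead c then a else ctape c i).

Definition input_tape (w : seq Sigma) (i : int) : tape_symbol :=
  if i is Posz m then omap inl (onth w m) else None.

Definition initial (w : seq Sigma) : config := Config (start T) 0 (input_tape w).

Definition answers (w : seq Sigma) (b : bool) : Prop :=
  exists m : nat,
    verdict (cstate (iter m step (initial w))) = Some b /\
    forall m' : nat, (m' < m)%N ->
      verdict (cstate (iter m' step (initial w))) = None.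

End Run.

Definition TM_decidable (X : Type) (enc : X -> seq Sigma) (P : X -> Prop) :
    Prop :=
  exists T : TM, forall x : X,
    exists b : bool, answers T (enc x) b /\ (b <-> P x).

End Turing.

(* Main.v *)
(** The shift of the i-th factor moves a head along the i-th tape, and the lamps of
    the first two factors act, in the spectral picture, by multiplication by the
    signs given by the bits written on two random read-only tapes. A two-headed
    reversible automaton on these tapes, carrying moreover a counter (the shift of
    the third factor), therefore gives a matrix over Z[G] whose row for the state q
    reads
      2^w (xi_q - sum over the patterns a of Pi_a t^d xi_q'),
    where (q', d) is the transition from q on reading a. A kernel vector is constant
    along the orbits of the automaton; as it is square-summable it vanishes on
    infinite orbits, and as it vanishes when the automaton gets stuck, the kernel is
    nontrivial iff some pair of tapes carries a cycle. Instead of a Fourier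
    transform, kernel vectors are decomposed under the right translations by
    finitely many lamps.

    The automaton checks that both tapes contain the same space-time diagram of a
    Turing machine T. Both heads move right comparing the tapes, then one head steps
    back by one row, both move left checking the local rule between consecutive
    rows, and the first row is checked last. While doing so the counter is
    incremented once per occurrence of a block in the first row; a single jump of
    the counter by -N closes the cycle iff there are exactly N blocks. The jump is
    one group element t^N, so the encoding of the matrix M_N is p followed by a
    block repeated N times, with p independent of N; the diagram also runs a counter
    checking that its input starts with the word whose numeral is N. For a decision
    procedure T and N the numeral of p, the diagram exists iff T accepts the
    encoding of M_N, that is, iff T claims that the kernel of M_N is trivial. *)
Require Import Defs.
From HB Require Import structures.
From mathcomp Require Import all_boot all_order all_algebra.
From mathcomp Require Import finmap.
From mathcomp Require Import boolp classical_sets functions cardinality fsbigop reals ereal esum.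
From mathcomp Require Import complex zify.
From mathcomp Require Import -(notations) monalg.

Set Implicit Arguments.
Unset Strict Implicit.
Unset Printing Implicit Defensive.

Import Order.TTheory GRing.Theory Num.Theory.
Local Open Scope ring_scope.

(** * Lamps and translations *)

Section Lamps.

Definition translation (u : int * int * int) : lamplighter3 :=
  ((0, u.1.1), (0, u.1.2), (0, u.2)).

Definition lamp (f : {malg 'Z_2[int]} * {malg 'Z_2[int]}) : lamplighter3 :=
  ((f.1, 0), (f.2, 0), (0, 0)).

Definition shift2 (u : int * int * int) (f : {malg 'Z_2[int]} * {malg 'Z_2[int]}) :=
  (shift u.1.1 f.1, shift u.1.2 f.2).

Lemma shift_0r n : shift n 0 = 0.
Proof. by apply/monalg.malgP => i; rewrite shiftE !monalg.mcoeff0. Qed.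

Lemma translationD u v : (translation u * translation v)%g = translation (u + v).
Proof.
by rewrite /translation; congr (_, _, _); rewrite -[LHS]/(lmul _ _) /lmul /=
  shift_0r addr0.
Qed.

Lemma translation0 : translation 0 = 1%g.
Proof. by []. Qed.

Lemma translationN u : translation (- u) = (translation u)^-1%g.
Proof.
by apply: (mulgI (translation u)); rewrite translationD subrr mulgV.
Qed.

Lemma lampD f g : (lamp f * lamp g)%g = lamp (f + g).
Proof.
rewrite /lamp; congr (_, _, _); rewrite -[LHS]/(lmul _ _) /lmul /= ?shift0 //.
by rewrite !addr0.
Qed.

Lemma lamp0 : lamp 0 = 1%g.
Proof. by []. Qed.

Lemma lamp_translation f u :
  (lamp f * translation (- u))%g = (translation (- u) * lamp (shift2 u f))%g.
Proof.
rewrite /translation /lamp; congr (_, _, _); rewrite -[LHS]/(lmul _ _) -[RHS]/(lmul _ _) /lmul /=.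
- by rewrite shift_0r -shiftD addNr shift0 !addr0 !add0r.
- by rewrite shift_0r -shiftD addNr shift0 !addr0 !add0r.
- by rewrite !shift_0r !addr0 !add0r.
Qed.

Lemma oppr_Z2 (a : 'Z_2) : - a = a.
Proof. by apply/val_inj; case: a => [[|[|[]]]]. Qed.

Lemma oppr_malg2 (f : {malg 'Z_2[int]}) : - f = f.
Proof. by apply/monalg.malgP => i; rewrite monalg.mcoeffN oppr_Z2. Qed.

Lemma lampV f : (lamp f)^-1%g = lamp f.
Proof.
apply: (mulgI (lamp f)); rewrite mulgV lampD -lamp0; congr lamp.
by case: f => f g; congr pair; rewrite -[X in X + _]oppr_malg2 addNr.
Qed.

Section Window.
Variable L : nat.
Implicit Types (F : {ffun bool * 'I_L -> 'Z_2}) (b u : int * int * int).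

Definition window b F : {malg 'Z_2[int]} * {malg 'Z_2[int]} :=
  (\sum_(i < L) << F (false, i) *g b.1.1 + i%:Z >>,
   \sum_(i < L) << F (true, i) *g b.1.2 + i%:Z >>).

Definition coefs b (f : {malg 'Z_2[int]} * {malg 'Z_2[int]}) : {ffun bool * 'I_L -> 'Z_2} :=
  [ffun c : bool * 'I_L => if c.1 then f.2@_(b.1.2 + c.2%:Z) else f.1@_(b.1.1 + c.2%:Z)].

Lemma windowD b F F' : window b (F + F') = window b F + window b F'.
Proof.
rewrite /window; congr pair; rewrite /= -big_split /=; apply: eq_bigr => i _;
by rewrite ffunE monalg.monalgUD.
Qed.

Lemma window0 b : window b 0 = 0.
Proof.
by rewrite /window; congr pair; rewrite /= big1 // => i _; rewrite ffunE monalg.monalgU0.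
Qed.

Lemma coefsD b f g : coefs b (f + g) = coefs b f + coefs b g.
Proof.
by apply/ffunP => -[[] i]; rewrite !ffunE /= monalg.mcoeffD.
Qed.

Lemma mcoeff_window_sum (a : int) (G : 'I_L -> 'Z_2) (j : int) :
  (\sum_(i < L) << G i *g a + i%:Z >>)@_j = \sum_(i < L) G i *+ (a + i%:Z == j).
Proof.
by rewrite raddf_sum /=; apply: eq_bigr => i _; rewrite monalg.mcoeffU.
Qed.

Lemma mcoeff_window_sum_in (a : int) (G : 'I_L -> 'Z_2) (i : 'I_L) :
  (\sum_(i < L) << G i *g a + i%:Z >>)@_(a + i%:Z) = G i.
Proof.
rewrite mcoeff_window_sum (bigD1 i) //= eqxx big1 ?addr0 // => j ji.
rewrite (inj_eq (addrI a)) eqz_nat; case: eqP => // /val_inj e.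
by rewrite e eqxx in ji.
Qed.

Lemma windowK b : cancel (window b) (coefs b).
Proof.
by move=> F; apply/ffunP => -[[] i]; rewrite !ffunE /= mcoeff_window_sum_in.
Qed.

Lemma shift_window b u F : shift2 u (window b F) = window (b + u) F.
Proof.
have sh n (a : int) (G : 'I_L -> 'Z_2) :
    shift n (\sum_(i < L) << G i *g a + i%:Z >>) = \sum_(i < L) << G i *g (a + n) + i%:Z >>.
  apply/monalg.malgP => j; rewrite shiftE !mcoeff_window_sum.
  apply: eq_bigr => i _; congr (_ *+ (_ : bool)).
  by apply/eqP/eqP; lia.
by rewrite /shift2 /window /= !sh.
Qed.

End Window.

Definition inside (a b : int) (l L : nat) : Prop := b <= a /\ a + l%:Z <= b + L%:Z.

(** [window b (coefs L b f)] restricts [f] to the window at [b], so it fixes whatever is supported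
    there. *)
Lemma window_inside l L u b (F : {ffun bool * 'I_l -> 'Z_2}) :
  inside u.1.1 b.1.1 l L -> inside u.1.2 b.1.2 l L ->
  window b (coefs L b (window u F)) = window u F.
Proof.
have in1 (x y : int) (G : 'I_l -> 'Z_2) : inside x y l L ->
    \sum_(k < L) << (\sum_(i < l) << G i *g x + i%:Z >>)@_(y + k%:Z) *g y + k%:Z >>
    = \sum_(i < l) << G i *g x + i%:Z >>.
  move=> [h1 h2]; set f := \sum_(i < l) _; apply/monalg.malgP => j.
  rewrite mcoeff_window_sum; case: (boolP ((y <= j) && (j < y + L%:Z))) => hj.
    have kL : (`|j - y| < L)%N by lia.
    rewrite (bigD1 (Ordinal kL)) //= big1 ?addr0; last first.
      move=> k kj; case: eqP => // e; exfalso; move/eqP: kj; apply.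
      by apply/val_inj => /=; lia.
    have -> : y + (`|j - y|%N)%:Z = j by clear -hj; lia.
    by rewrite eqxx.
  rewrite big1; last by move=> k _; case: eqP => // e; have := ltn_ord k; lia.
  rewrite mcoeff_window_sum big1 // => i _; case: eqP => // e.
  by have := ltn_ord i; lia.
move=> h1 h2; rewrite [in LHS]/window /=; congr pair.
  by under eq_bigr do rewrite ffunE /=; rewrite in1.
by under eq_bigr do rewrite ffunE /=; rewrite in1.
Qed.

Implicit Types (x : bool -> int -> bool).

Definition sign2 (a : 'Z_2) : int := if a == 0 then 1 else -1.

Lemma sign2D a b : sign2 (a + b) = sign2 a * sign2 b.
Proof. by case: a => [[|[|[]]]] //= ?; case: b => [[|[|[]]]]. Qed.

Definition pairing (y : int -> bool) (f : {malg 'Z_2[int]}) : 'Z_2 :=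
  monalg.mmap idfun (fun i => (y i)%:R) f.

Lemma pairingD y f g : pairing y (f + g) = pairing y f + pairing y g.
Proof. exact: monalg.mmapD. Qed.

Lemma pairing_sum y (I : Type) (r : seq I) (F : I -> {malg 'Z_2[int]}) :
  pairing y (\sum_(i <- r) F i) = \sum_(i <- r) pairing y (F i).
Proof.
apply: (big_morph (pairing y) (pairingD y)); exact: monalg.mmap0.
Qed.

(** The character of the lamps of the first two factors given by a pair of tapes: the Pontryagin
    dual of a direct sum of copies of Z/2 is the space of bit sequences. *)
Definition chi x f : int := sign2 (pairing (x false) f.1) * sign2 (pairing (x true) f.2).

Lemma chiD x f g : chi x (f + g) = chi x f * chi x g.
Proof. by rewrite /chi /= !pairingD !sign2D mulrACA. Qed.

(** Character table of the finite group of functions [J -> 'Z_2], the characters being indexed by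
    bit patterns. *)
Definition pattern_sign (J : finType) (a : {ffun J -> bool}) (F : {ffun J -> 'Z_2}) : int :=
  \prod_j sign2 (F j * (a j)%:R).

Definition read L x (u : int * int * int) : {ffun bool * 'I_L -> bool} :=
  [ffun c : bool * 'I_L => x c.1 ((if c.1 then u.1.2 else u.1.1) + c.2%:Z)].

Lemma chi_window L x u (F : {ffun bool * 'I_L -> 'Z_2}) :
  chi x (window u F) = pattern_sign (read L x u) F.
Proof.
rewrite /chi /pattern_sign /window /= !pairing_sum.
have pU y a i : pairing y << a *g i >> = a * (y i)%:R by rewrite /pairing monalg.mmapU.
do 2! rewrite (big_morph _ sign2D (erefl : sign2 0 = 1)).
transitivity (\prod_(c : bool) \prod_(i < L) sign2 (F (c, i) * (read L x u (c, i))%:R)).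
  by rewrite big_bool /= mulrC; congr (_ * _); apply: eq_bigr => i _; rewrite pU ffunE.
by rewrite pair_bigA /=; apply: eq_bigr => -[].
Qed.

Lemma pattern_signD (J : finType) a (F F' : {ffun J -> 'Z_2}) :
  pattern_sign a (F + F') = pattern_sign a F * pattern_sign a F'.
Proof.
by rewrite /pattern_sign -big_split; apply: eq_bigr => j _; rewrite ffunE mulrDl sign2D.
Qed.

(** The sum factors over [J]: a coordinate where the patterns differ contributes 1 - 1, any other
    contributes 2. *)
Lemma pattern_sign_orthogonal (J : finType) (a a' : {ffun J -> bool}) :
  \sum_F pattern_sign a F * pattern_sign a' F = (2 ^+ #|J|) *+ (a == a').
Proof.
under eq_bigr => F _ do rewrite /pattern_sign -big_split /=.
rewrite -(bigA_distr_bigA (fun j z => sign2 (z * (a j)%:R) * sign2 (z * (a' j)%:R))) /=.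
have e j : \sum_(z : 'Z_2) sign2 (z * (a j)%:R) * sign2 (z * (a' j)%:R)
    = if a j == a' j then 2 else 0.
  by rewrite !big_ord_recl big_ord0; case: (a j); case: (a' j).
under eq_bigr => j _ do rewrite e.
case: eqP => [->|ne]; last first.
  have [j /eqP aj] : exists j, a j <> a' j.
    by apply: contrapT => h; apply: ne; apply/ffunP => j; apply: contrapT => k; apply: h; exists j.
  by rewrite (bigD1 j) //= (negPf aj) mul0r.
by under eq_bigr => j _ do rewrite eqxx; rewrite prodr_const cardT.
Qed.

Lemma pattern_sign_orthogonal2 (J : finType) (F F' : {ffun J -> 'Z_2}) :
  \sum_a pattern_sign a F * pattern_sign a F' = (2 ^+ #|J|) *+ (F == F').
Proof.
under eq_bigr => a _ do rewrite /pattern_sign -big_split /=.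
rewrite -(bigA_distr_bigA (fun j (z : bool) => sign2 (F j * z%:R) * sign2 (F' j * z%:R))) /=.
have e j : \sum_(z : bool) sign2 (F j * z%:R) * sign2 (F' j * z%:R)
    = if F j == F' j then 2 else 0.
  rewrite big_bool; case: (F j) => [[|[|[]]]] //= ?; case: (F' j) => [[|[|[]]]] //= ?;
  by rewrite -val_eqE.
under eq_bigr => j _ do rewrite e.
case: eqP => [->|ne]; last first.
  have [j /eqP aj] : exists j, F j <> F' j.
    by apply: contrapT => h; apply: ne; apply/ffunP => j; apply: contrapT => k; apply: h; exists j.
  by rewrite (bigD1 j) //= (negPf aj) mul0r.
by under eq_bigr => j _ do rewrite eqxx; rewrite prodr_const cardT.
Qed.

(** Coordinates of the factorisation [h = translation (- u) * lamp3 f c]. With this sign, left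
    multiplication by [translation (- r)] moves the position by [r]. *)
Definition position (h : lamplighter3) : int * int * int :=
  (- h.1.1.2, - h.1.2.2, - h.2.2).

Definition lamps (h : lamplighter3) := shift2 (position h) (h.1.1.1, h.1.2.1).

Definition lamp3 (f : {malg 'Z_2[int]} * {malg 'Z_2[int]}) (c : {malg 'Z_2[int]}) : lamplighter3 :=
  ((f.1, 0), (f.2, 0), (c, 0)).

Lemma lamp_lamp3 f g c : (lamp f * lamp3 g c)%g = lamp3 (f + g) c.
Proof.
rewrite /lamp /lamp3; congr (_, _, _); rewrite -[LHS]/(lmul _ _) /lmul /= ?shift0 ?addr0 //.
by rewrite add0r.
Qed.

Lemma translation_lamp3 u f c : (translation (- u) * lamp3 f c)%g =
  ((shift (- u.1.1) f.1, - u.1.1), (shift (- u.1.2) f.2, - u.1.2), (shift (- u.2) c, - u.2)) :> lamplighter3.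
Proof.
by rewrite /translation /lamp3; congr (_, _, _); rewrite -[LHS]/(lmul _ _) /lmul /= addr0 add0r.
Qed.

Lemma lamp3_surj h : exists c, (h = translation (- position h) * lamp3 (lamps h) c)%g.
Proof.
exists (shift (position h).2 h.2.1); rewrite translation_lamp3 /lamps /position /=.
by case: h => [[[? ?] [? ?]] [? ?]]; rewrite /= -!shiftD !opprK !subrr !shift0.
Qed.

Lemma position_lamp3 u f c : position (translation (- u) * lamp3 f c)%g = u.
Proof. by rewrite translation_lamp3 /position /= !opprK; case: u => [[]]. Qed.

Lemma lamps_lamp3 u f c : lamps (translation (- u) * lamp3 f c)%g = f.
Proof.
rewrite /lamps position_lamp3 translation_lamp3 /shift2 /= -!shiftD !subrr !shift0.
by case: f.
Qed.

Lemma lamp3_0 f : lamp3 f 0 = lamp f.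
Proof. by []. Qed.

Lemma translation_lamp_inj L b :
  injective (fun p : (int * int * int) * {ffun bool * 'I_L -> 'Z_2} =>
    (translation (- p.1) * lamp (window b p.2))%g).
Proof.
move=> [u F] [u' F']; rewrite -!lamp3_0 => e.
have := congr1 position e; rewrite !position_lamp3 => /= ->.
have := congr1 lamps e; rewrite !lamps_lamp3 => /= /(can_inj (windowK b)) ->.
by [].
Qed.

End Lamps.

(** * Harmonic families and orbits of two-headed automata *)

Section Automaton.

Variables (Q : finType) (w : nat).
Variable nx : Q -> {ffun bool * 'I_w -> bool} -> option (Q * (int * int * int)).
Local Notation vertex := (Q * (int * int * int))%type.
Local Notation card := (#|{: bool * 'I_w}|).

Definition vnext (x : bool -> int -> bool) (v : vertex) : option vertex :=
  omap (fun r => (r.1, v.2 + r.2)) (nx v.1 (read w x v.2)).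

Definition vrun (x : bool -> int -> bool) n (v : vertex) : option vertex :=
  iter n (obind (vnext x)) (Some v).

Section Pull.
Variable V : zmodType.
Implicit Type xi : Q -> lamplighter3 -> V.

(** The signed sum over [F] is [2 ^+ card] times the projection onto the tapes showing the pattern
    [a] under the heads; [harmonic] is thus the kernel equation with denominators cleared. *)
Definition pull xi q h : V :=
  \sum_a (if nx q a is Some r then
    \sum_(F : {ffun bool * 'I_w -> 'Z_2})
      xi r.1 (translation (- r.2) * lamp (window 0 F) * h)%g *~ pattern_sign a F
    else 0).

Definition harmonic xi : Prop := forall q h, xi q h *~ (2 ^+ card) = pull xi q h.

(** [pull] multiplies on the left only, which is what permits decomposing harmonic families under
    right translations by lamps. *)
Lemma pull_right xi k q h :
  pull (fun q h => xi q (h * k)%g) q h = pull xi q (h * k)%g.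
Proof.
by apply: eq_bigr => a _; case: nx => // r; apply: eq_bigr => F _; rewrite !mulgA.
Qed.

Lemma pull_sumz (I : finType) (X : I -> Q -> lamplighter3 -> V) (c : I -> int) q h :
  pull (fun q h => \sum_i X i q h *~ c i) q h = \sum_i pull (X i) q h *~ c i.
Proof.
under [RHS]eq_bigr => i _ do rewrite mulrz_suml.
rewrite [RHS]exchange_big; apply: eq_bigr => a _.
case: nx => [r|]; last by rewrite big1 // => i _; rewrite mul0rz.
under [RHS]eq_bigr => i _ do rewrite mulrz_suml.
rewrite [RHS]exchange_big; apply: eq_bigr => F _.
by rewrite mulrz_suml; apply: eq_bigr => i _; rewrite mulrzAC.
Qed.

(** When the lamps under the heads act by the character of [x], orthogonality leaves only the
    pattern that [x] really shows, and [pull] becomes evaluation at the successor vertex. *)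
Lemma pull_translation xi x q u :
  (forall a r F, nx q a = Some r -> xi r.1 (translation (- (u + r.2)) * lamp (window u F))%g =
     xi r.1 (translation (- (u + r.2))) *~ pattern_sign (read w x u) F) ->
  pull xi q (translation (- u)) =
  if vnext x (q, u) is Some v then xi v.1 (translation (- v.2)) *~ 2 ^+ card else 0.
Proof.
move=> eqv; rewrite /pull /vnext /=.
have e (a : {ffun bool * 'I_w -> bool}) (r : Q * (int * int * int)) : nx q a = Some r ->
   \sum_F xi r.1 (translation (- r.2) * lamp (window 0 F) * translation (- u))%g *~
     pattern_sign a F =
   xi r.1 (translation (- (u + r.2))) *~ ((2 ^+ card) *+ (read w x u == a)).
  move=> ra; rewrite -pattern_sign_orthogonal mulrz_sumr; apply: eq_bigr => F _.
  rewrite -mulgA lamp_translation mulgA translationD shift_window add0r.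
  by rewrite -opprD addrC (eqv _ _ _ ra) mulrzA.
rewrite (bigD1 (read w x u)) //= big1 ?addr0; last first.
  move=> a ne; case ra: nx => [r|] //; rewrite (e _ _ ra) eq_sym (negPf ne).
  by rewrite mulr0z.
by case ra: nx => [r|] //=; rewrite (e _ _ ra) eqxx.
Qed.

End Pull.

(** * Vanishing of square-summable harmonic families without cycles *)

Section Trivial.
Variable R : realType.
Implicit Type xi : Q -> lamplighter3 -> R.

Lemma sum_uniq_le (T : eqType) (F : T -> R) (s t : seq T) :
  (forall a, 0 <= F a) -> uniq s -> uniq t -> {subset s <= t} ->
  \sum_(a <- s) F a <= \sum_(a <- t) F a.
Proof.
move=> F0 us ut st.
have -> : \sum_(a <- s) F a = \sum_(a <- t | a \in s) F a.
  rewrite -[RHS]big_filter; apply: perm_big; apply: uniq_perm => //; first exact: filter_uniq.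
  by move=> a; rewrite mem_filter; apply/idP/andP => [h|[]//]; split=> //; exact: st.
by rewrite (bigID (fun a => a \in s) xpredT) /= lerDl sumr_ge0.
Qed.

(** Parseval without normalisation: after expanding the square, summing over [x] first leaves the
    diagonal terms. *)
Lemma parseval (I : finType) (g : {ffun I -> 'Z_2} -> R) :
  \sum_(x : {ffun I -> bool}) (\sum_F g F *~ pattern_sign x F) ^+ 2 =
  (\sum_F g F ^+ 2) *~ (2 ^+ #|I|).
Proof.
under eq_bigr => x _.
  rewrite expr2 mulr_suml; under eq_bigr => F _ do rewrite mulr_sumr.
  over.
rewrite exchange_big mulrz_suml; apply: eq_bigr => F _.
rewrite exchange_big /= (bigD1 F) //= [X in _ + X]big1 ?addr0; last first.
  move=> F' ne; transitivity ((g F * g F') *~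
      \sum_(x : {ffun I -> bool}) pattern_sign x F * pattern_sign x F').
    by rewrite mulrz_sumr; apply: eq_bigr => x _; rewrite mulrzAl mulrzAr -mulrzA [X in _ *~ X]mulrC.
  by rewrite pattern_sign_orthogonal2 eq_sym (negPf ne) mulr0z.
transitivity ((g F * g F) *~
      \sum_(x : {ffun I -> bool}) pattern_sign x F * pattern_sign x F).
  by rewrite mulrz_sumr; apply: eq_bigr => x _; rewrite mulrzAl mulrzAr -mulrzA [X in _ *~ X]mulrC.
by rewrite pattern_sign_orthogonal2 eqxx expr2.
Qed.

Lemma run_add x m n v u : vrun x m v = Some u -> vrun x (n + m) v = vrun x n u.
Proof. by rewrite /vrun iterD => ->. Qed.

Lemma run_None x m n v : (m <= n)%N -> vrun x m v = None -> vrun x n v = None.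
Proof.
move=> mn; rewrite /vrun -(subnK mn) iterD => ->.
by elim: (n - m)%N => //= k ->.
Qed.

Lemma runS x n v : vrun x n.+1 v = obind (vnext x) (vrun x n v).
Proof. by []. Qed.

Lemma move_bound : exists D : nat, forall q a r, nx q a = Some r ->
  (`|r.2.1.1| <= D)%N /\ (`|r.2.1.2| <= D)%N.
Proof.
pose d (p : Q * {ffun bool * 'I_w -> bool}) :=
  if nx p.1 p.2 is Some r then maxn `|r.2.1.1| `|r.2.1.2| else 0%N.
exists (\max_p d p)%N => q a r e; apply/andP; rewrite -geq_max.
by have := leq_bigmax (F := d) (q, a); rewrite /d /= e.
Qed.

Lemma run_bound D x n q v :
  (forall q a r, nx q a = Some r -> (`|r.2.1.1| <= D)%N /\ (`|r.2.1.2| <= D)%N) ->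
  vrun x n (q, 0) = Some v -> (`|v.2.1.1| <= n * D)%N /\ (`|v.2.1.2| <= n * D)%N.
Proof.
move=> hD; elim: n v => [|n IH] v; first by case=> <-.
rewrite runS; case e: vrun => [u|] //=; rewrite /vnext.
case er: nx => [r|] //= [<-] /=; have [h1 h2] := IH _ e; have [h3 h4] := hD _ _ _ er.
by rewrite !mulSn; split; lia.
Qed.

(** The filling by [false] outside the window is harmless, since orbits are followed only while the
    heads read inside it. *)
Definition extend L (b : int * int * int) (y : {ffun bool * 'I_L -> bool}) : bool -> int -> bool :=
  fun c i => [exists k : 'I_L, (i == (if c then b.1.2 else b.1.1) + k%:Z) && y (c, k)].

Lemma read_extend L b (y : {ffun bool * 'I_L -> bool}) : read L (extend b y) b = y.
Proof.
apply/ffunP => -[c i]; rewrite !ffunE /extend /=; apply/existsP/idP => [[k]|h].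
  by case/andP => /eqP e; have -> : i = k by apply/val_inj => /=; lia.
by exists i; rewrite eqxx.
Qed.

Section Isotypic.
Variables (L : nat) (b : int * int * int) (x : bool -> int -> bool) (xi : Q -> lamplighter3 -> R).

(* The part of [xi] on which the lamps of the window act on the right by the character
   given by [x]; it is constant along the orbits on the tapes [x] inside the window. *)
Definition isotypic q h : R :=
  \sum_(F : {ffun bool * 'I_L -> 'Z_2})
    xi q (h * lamp (window b F))%g *~ pattern_sign (read L x b) F.

(** Reindexing by [F' -> F + F'] brings out the sign of [F], because [F + F = 0]. *)
Lemma isotypic_lamp q h F :
  isotypic q (h * lamp (window b F))%g = isotypic q h *~ pattern_sign (read L x b) F.
Proof.
rewrite /isotypic [in RHS](reindex_inj (addrI F)) /= mulrz_suml; apply: eq_bigr => F' _.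
rewrite -mulgA lampD -windowD -mulrzA pattern_signD mulrAC -pattern_signD.
have -> : F + F = 0 by apply/ffunP => i; rewrite !ffunE -[X in X + _]oppr_Z2 addNr.
rewrite [pattern_sign _ 0]big1 ?mul1r // => j _; by rewrite ffunE mul0r.
Qed.

Lemma isotypic_harmonic : harmonic xi -> harmonic isotypic.
Proof.
move=> hxi q h; rewrite pull_sumz mulrz_suml; apply: eq_bigr => F _.
by rewrite pull_right -hxi mulrzAC.
Qed.

(** What the heads read lies in the window, so the lamps there act by the character of [x] and
    [pull_translation] applies. *)
Lemma isotypic_next q u :
  harmonic xi -> inside u.1.1 b.1.1 w L -> inside u.1.2 b.1.2 w L ->
  isotypic q (translation (- u)) =
  if vnext x (q, u) is Some v then isotypic v.1 (translation (- v.2)) else 0.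
Proof.
move=> hxi h1 h2; have := isotypic_harmonic hxi q (translation (- u)).
rewrite (pull_translation (x := x)); last first.
  move=> a r F _; rewrite -(window_inside F h1 h2) isotypic_lamp; congr (_ *~ _).
  by rewrite -!chi_window window_inside.
have p0 : (2 ^+ card)%:~R != 0 :> R by rewrite intr_eq0 expf_neq0.
case: vnext => [v|] e; apply: (mulIf p0); rewrite ?mul0r !mulrzr //.
Qed.

End Isotypic.

Lemma abs_inside (a : int) (k K l L : nat) :
  (`|a| <= k)%N -> (k <= K)%N -> (2 * K + l <= L)%N -> inside a (- K%:Z) l L.
Proof. by move=> h1 h2 h3; split; lia. Qed.

(** In [m] steps of size at most [D] the heads stay within [m * D] of the origin, so the window
    contains everything they read. *)
Lemma isotypic_run L b x xi D q m n :
  (forall q a r, nx q a = Some r -> (`|r.2.1.1| <= D)%N /\ (`|r.2.1.2| <= D)%N) ->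
  harmonic xi ->
  b.1.1 = - (m * D)%N%:Z -> b.1.2 = - (m * D)%N%:Z -> (2 * (m * D) + w <= L)%N ->
  (n <= m)%N ->
  isotypic L b x xi q 1%g =
  if vrun x n (q, 0) is Some v then isotypic L b x xi v.1 (translation (- v.2)) else 0.
Proof.
move=> hD hxi b1 b2 hL; elim: n => [|n IH] nm; first by rewrite /= oppr0 translation0.
rewrite IH ?(ltnW nm) // runS; case e: vrun => [[q' u]|] //=.
have [/= h1 h2] := run_bound hD e.
have nmD : (n * D <= m * D)%N by rewrite leq_mul2r (ltnW nm) orbT.
by rewrite isotypic_next // ?b1 ?b2; apply: abs_inside; eauto.
Qed.

(** An isotypic value at 1 is repeated at [m] distinct vertices of an orbit, or is 0 if the orbit
    gets stuck. Summing squares over all characters of the window turns this, by Parseval, into [m]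
    times the square of [xi q 1] being at most [C]; as [m] is arbitrary, [xi q 1] is 0. *)
Theorem harmonic_eq0 xi (C : R) :
  harmonic xi ->
  (forall s : seq (Q * lamplighter3), uniq s -> \sum_(p <- s) xi p.1 p.2 ^+ 2 <= C) ->
  (forall x n v, (0 < n)%N -> vrun x n v <> Some v) ->
  forall q g, xi q g = 0.
Proof.
move=> hxi hC acyc q g.
wlog -> : xi g hxi hC / g = 1%g.
  move=> W; rewrite -[g]mul1g; apply: (W (fun q h => xi q (h * g)%g)) => //.
    by move=> q' h; rewrite pull_right -hxi.
  move=> s us; rewrite -(big_map (fun p => (p.1, (p.2 * g)%g)) xpredT (fun p => xi p.1 p.2 ^+ 2)).
  apply: hC; rewrite map_inj_uniq // => -[q1 h1] [q2 h2] e.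
  have e2 : (h1 * g = h2 * g)%g := congr1 snd e.
  by rewrite (congr1 fst e : q1 = q2) (mulIg _ _ _ e2).
have [D hD] := move_bound.
suff key (m : nat) : xi q 1%g ^+ 2 *+ m <= C.
  apply/eqP; rewrite -sqrf_eq0; apply: contrapT => /negP ne.
  have p0 : 0 < xi q 1%g ^+ 2 by rewrite lt_def ne sqr_ge0.
  have C0 : 0 <= C by have := key 0%N; rewrite mulr0n.
  have := key (Num.trunc (C / xi q 1%g ^+ 2)).+1.
  rewrite -mulr_natr mulrC -ler_pdivlMr // leNgt => /negP; apply.
  exact: truncnS_gt.
pose K := (m * D)%N; pose L := (2 * K + w)%N.
pose b : int * int * int := (- K%:Z, - K%:Z, 0).
pose I : finType := {ffun bool * 'I_L -> bool}.
(* All vertices reached from [(q, 0)] in fewer than [m] steps, for any content of the window. *)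
pose s := undup (pmap id [seq vrun (extend b y) j (q, 0) | y <- enum I, j <- iota 0 m]).
have step (y : I) : isotypic L b (extend b y) xi q 1%g ^+ 2 *+ m <=
    \sum_(v <- s) isotypic L b (extend b y) xi v.1 (translation (- v.2)) ^+ 2.
  set x := extend b y; set f := isotypic L b x xi.
  have [-> | f0] := eqVneq (f q 1%g) 0.
    by rewrite expr0n /= mul0rn sumr_ge0 // => v _; rewrite sqr_ge0.
  (* Getting stuck within [m] steps would make the isotypic value 0, so here the run is defined and
     keeps the value. *)
  have val n : (n <= m)%N -> {v | vrun x n (q, 0) = Some v & f q 1%g = f v.1 (translation (- v.2))}.
    move=> nm; have := isotypic_run (L := L) (b := b) x q hD hxi erefl erefl (leqnn _) nm.
    rewrite -/f; case: vrun => [v|] e; first by exists v.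
    by rewrite e eqxx in f0.
  pose p := [seq odflt (q, 0) (vrun x j (q, 0)) | j <- iota 0 m].
  have pE j : j \in iota 0 m -> vrun x j (q, 0) = Some (odflt (q, 0) (vrun x j (q, 0))).
    by rewrite mem_iota => /andP[_ /ltnW/val[v ->]].
  have <- : \sum_(v <- p) f v.1 (translation (- v.2)) ^+ 2 = f q 1%g ^+ 2 *+ m.
    rewrite big_map big_seq (eq_bigr (fun=> f q 1%g ^+ 2)).
      by rewrite -big_seq big_const_seq count_predT size_iota iter_addr_0.
    by move=> j; rewrite mem_iota => /andP[_ /ltnW/val[v -> ->]].
  apply: sum_uniq_le; rewrite ?undup_uniq //.
  - by move=> v; rewrite sqr_ge0.
  (* A repeated vertex would be a cycle. *)
  - rewrite map_inj_in_uniq ?iota_uniq // => i j hi hj e.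
    wlog ij : i j hi hj e / (i <= j)%N.
      by move=> W; case: (leqP i j) => [/W|/ltnW/W h]; [exact|apply/esym/h].
    apply/eqP; apply: contrapT => /negP ne.
    have ri := pE _ hi; have rj := pE _ hj.
    apply: (acyc x (j - i)%N (odflt (q, 0) (vrun x i (q, 0)))); first by lia.
    by rewrite -(run_add _ ri) subnK // rj e.
  - move=> v /mapP[j hj ->]; rewrite mem_undup mem_pmap map_id -pE //.
    by apply/allpairsP; exists (y, j) => /=; rewrite mem_enum.
have := ler_sum (index_enum I) (fun y (_ : true) => step y).
rewrite sumrMnl [X in _ <= X]exchange_big /=.
(* Summing over the contents [y] is summing over all characters of the lamps of the window. *)
have E (q' : Q) h : \sum_(y : I) isotypic L b (extend b y) xi q' h ^+ 2 =
    (\sum_(F : {ffun bool * 'I_L -> 'Z_2}) xi q' (h * lamp (window b F))%g ^+ 2) *~ 2 ^+ #|{: bool * 'I_L}|.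
  apply: etrans (parseval (fun F : {ffun bool * 'I_L -> 'Z_2} =>
    xi q' (h * lamp (window b F))%g)); apply: eq_bigr => y _.
  by rewrite /isotypic read_extend.
rewrite E; under eq_bigr => v _ do rewrite E.
rewrite -mulrz_suml pmulrn mulrzAC -!pmulrn ler_pMz2r ?exprn_gt0 // => h.
(* On the left only [F = 0] is kept. On the right the group elements are pairwise distinct, so [C]
   bounds the sum. *)
apply: le_trans (le_trans h _).
  apply: ler_wMn2r; rewrite (bigD1 (0 : {ffun bool * 'I_L -> 'Z_2})) //= window0 lamp0 mulg1 lerDl.
  by rewrite sumr_ge0 // => F _; rewrite sqr_ge0.
pose t := [seq (v.1, (translation (- v.2) * lamp (window b F))%g) | v <- s, F <- enum {ffun bool * 'I_L -> 'Z_2}].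
apply: le_trans (hC t _).
  rewrite big_allpairs_dep /=; apply: ler_sum => v _.
  by rewrite big_enum.
apply: allpairs_uniq; rewrite ?undup_uniq ?enum_uniq //.
move=> [[q1 u1] F1] [[q2 u2] F2] _ _ e.
rewrite (congr1 fst e : q1 = q2).
by have := @translation_lamp_inj L b (u1, F1) (u2, F2) (congr1 snd e); case=> -> ->.
Qed.

End Trivial.
End Automaton.

(** * Finitely supported harmonic families from cycles *)

Section Cycle.

Variables (Q : finType) (w : nat).
Variable nx : Q -> {ffun bool * 'I_w -> bool} -> option (Q * (int * int * int)).
Local Notation vertex := (Q * (int * int * int))%type.
Local Notation card := (#|{: bool * 'I_w}|).
Local Notation vnext := (vnext nx).
Local Notation vrun := (vrun nx).

Section Support.
Variables (x : bool -> int -> bool) (S : seq vertex).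
Hypothesis S_next : forall v, v \in S -> exists2 v', v' \in S & vnext x v = Some v'.
Hypothesis S_prev : forall v v', vnext x v = Some v' -> v' \in S -> v \in S.

(** The positions bounded are those from which a transition would enter [S]: the window must contain
    what is read just before arriving. *)
Lemma support_bound : exists K : nat, forall (v : vertex) q a r, v \in S -> nx q a = Some r ->
  (`|v.2.1.1 - r.2.1.1| <= K)%N /\ (`|v.2.1.2 - r.2.1.2| <= K)%N.
Proof.
have [D hD] := move_bound nx.
pose d (v : vertex) := maxn `|v.2.1.1| `|v.2.1.2|.
exists (\max_(v <- S) d v + D)%N => v q a r vS e.
have : (d v <= \max_(v <- S) d v)%N.
  by apply: (@leq_bigmax_seq _ S xpredT d v).
rewrite /d geq_max => /andP[h1 h2]; have [h3 h4] := hD _ _ _ e.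
by split; lia.
Qed.

(** On the vertices of [S], [eta] is the character [chi x] cut down to the lamps of a finite window;
    elsewhere it is 0. Closure of [S] under successors and predecessors gives harmonicity through
    [pull_translation]. *)
Theorem harmonic_support : S != [::] ->
  exists eta : Q -> lamplighter3 -> int,
  [/\ harmonic nx eta, (exists q h, eta q h != 0) &
      exists s : seq (Q * lamplighter3), forall q h, eta q h != 0 -> (q, h) \in s].
Proof.
move=> S0; have [K hK] := support_bound.
pose L := (2 * K + w)%N.
pose b : int * int * int := (- K%:Z, - K%:Z, 0).
pose W f := window b (coefs L b f) == f.
have [eta etaE] : exists eta : Q -> lamplighter3 -> int, forall q u f c,
    eta q (translation (- u) * lamp3 f c)%g =
    if [&& (q, u) \in S, c == 0 & W f] then chi x f else 0.
  exists (fun q h => if [&& (q, position h) \in S, h.2.1 == 0 & W (lamps h)]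
    then chi x (lamps h) else 0) => q u f c.
  rewrite position_lamp3 lamps_lamp3 translation_lamp3.
  suff -> : (shift (- u.2) c == 0) = (c == 0) by [].
  apply/eqP/eqP => [e|->]; last exact: shift_0r.
  by rewrite -(shift0 c) -(subrr u.2) shiftD e shift_0r.
have chi2 f : chi x f * chi x f = 1.
  by rewrite /chi mulrACA /sign2; do 2 case: ifP => _.
exists eta; split.
- move=> q h; have [c hc] := lamp3_surj h.
  set u := position h in hc; set f := lamps h in hc.
  rewrite {}hc; rewrite -(pull_right _ eta) (@pull_translation _ _ nx _ _ x); last first.
    move=> a r F ra; case: (boolP ((r.1, u + r.2) \in S)) => [rS|/negPf rS]; last first.
      rewrite -[in LHS]mulgA lamp_lamp3 !etaE rS /=; by rewrite mul0rz.
    rewrite -mulgA lamp_lamp3 !etaE rS.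
    case: (eqVneq c 0) => c0 /=; last by rewrite mul0rz.
    have [u1 u2] : inside u.1.1 b.1.1 w L /\ inside u.1.2 b.1.2 w L.
      have [] := hK _ _ _ _ rS ra; rewrite /= !addrK => h1 h2.
      by split; apply: abs_inside (leqnn _) _.
    (* Adding lamps that lie in the window does not change whether [f] is supported in it. *)
    rewrite /W coefsD windowD window_inside // (inj_eq (addrI _)) chiD chi_window.
    by case: ifP; rewrite ?mul0rz // mulrzz mulrC.
  rewrite etaE.
  case e : (vnext x (q, u)) => [v|].
    rewrite etaE; have -> : ((q, u) \in S) = (v \in S).
      by apply/idP/idP => [/S_next[v' v'S]|/(S_prev e)//]; rewrite e => -[->].
    by case: v e => ? ? _ /=.
  have -> : (q, u) \in S = false; last by rewrite mul0rz.
  by apply/negP => /S_next[v' _]; rewrite e.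
- have [v vS] : exists v, v \in S by case: (S) S0 => // v S' _; exists v; rewrite mem_head.
  exists v.1, (translation (- v.2) * lamp3 0 0)%g; rewrite etaE -surjective_pairing vS eqxx.
  have -> : W 0.
    have c0 : coefs L b 0 = 0 by apply/ffunP => -[[] i]; rewrite !ffunE monalg.mcoeff0.
    by rewrite /W c0 window0.
  by apply/eqP => c0; have := chi2 0; rewrite c0 mul0r.
- exists [seq (v.1, (translation (- v.2) * lamp (window b F))%g) | v <- S, F <- enum {ffun bool * 'I_L -> 'Z_2}].
  move=> q h; have [c hc] := lamp3_surj h; move: hc.
  set u := position h; set f := lamps h => ->; rewrite etaE.
  case: ifP => [/and3P[uS /eqP c0 /eqP fW]|]; last by rewrite eqxx.
  move=> _; rewrite c0 lamp3_0 -fW.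
  by apply: (allpairs_f (fun v F => (v.1, (translation (- v.2) * lamp (window b F))%g)) uS);
    rewrite mem_enum.
Qed.
End Support.

(** A cycle is closed under successors, and injectivity of [vnext x] closes it under predecessors as
    well. *)
Theorem harmonic_cycle x n v : (0 < n)%N -> vrun x n v = Some v ->
  (forall u u' t, vnext x u = Some t -> vnext x u' = Some t -> u = u') ->
  exists eta : Q -> lamplighter3 -> int,
  [/\ harmonic nx eta, (exists q h, eta q h != 0) &
      exists s : seq (Q * lamplighter3), forall q h, eta q h != 0 -> (q, h) \in s].
Proof.
move=> n0 rn inj; pose S := [seq odflt v (vrun x j v) | j <- iota 0 n].
have rS j : (j <= n)%N -> vrun x j v = Some (odflt v (vrun x j v)).
  move=> jn; case e : (vrun x j v) => //.
  by have := run_None jn e; rewrite rn.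
have mS j : (j <= n)%N -> odflt v (vrun x j v) \in S.
  rewrite leq_eqVlt => /orP[/eqP ->|jn]; last by apply: map_f; rewrite mem_iota.
  by rewrite rn /=; apply/mapP; exists 0%N; rewrite ?mem_iota.
apply: (@harmonic_support x S).
- move=> u /mapP[j]; rewrite mem_iota add0n => jn ->.
  exists (odflt v (vrun x j.+1 v)); first exact: mS.
  by rewrite -rS // runS (rS j (ltnW jn)).
- move=> u t e /mapP[j]; rewrite mem_iota add0n => /andP[_ jn] te.
  (* The predecessor of [t] on the cycle; for [j = 0] the index wraps around to [n.-1]. *)
  have [k kn ke] : exists2 k, (k < n)%N & vrun x k.+1 v = Some t.
    case: j jn te => [_|j jn] te; last by exists j; rewrite ?(ltnW jn) // te -rS // ltnW.
    by exists n.-1; rewrite ?prednK // rn te.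
  move: ke; rewrite runS (rS k (ltnW kn)) /= => ke.
  by rewrite (inj _ _ _ e ke); apply: mS; exact: ltnW.
- by apply/eqP => S0; have := mS 0%N isT; rewrite S0.
Qed.

End Cycle.

(** * Tableaux recognised by a reversible two-headed automaton *)

Lemma add3 (a b c a' b' c' : int) : (a, b, c) + (a', b', c') = (a + a', b + b', c + c').
Proof. by []. Qed.

Inductive phase := Compare | Last | Check | First | Jump | Restart.

Definition phase_code (q : phase) : 'I_6 :=
  match q with
  | Compare => @Ordinal 6 0 isT | Last => @Ordinal 6 1 isT
  | Check => @Ordinal 6 2 isT | First => @Ordinal 6 3 isT
  | Jump => @Ordinal 6 4 isT | Restart => @Ordinal 6 5 isT
  end.
Definition phase_decode (i : 'I_6) : phase :=
  nth Restart [:: Compare; Last; Check; First; Jump; Restart] i.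
Lemma phase_codeK : cancel phase_code phase_decode.
Proof. by case. Qed.
HB.instance Definition _ := Finite.copy phase (can_type phase_codeK).

Inductive tape_cell (C : Type) := LeftEnd | RightEnd | Separator | Cell of C.
Arguments LeftEnd {C}.
Arguments RightEnd {C}.
Arguments Separator {C}.

Section TapeCell.
Variable C : finType.
Definition cell_code (a : tape_cell C) : option (option (option C)) :=
  match a with
  | LeftEnd => None | RightEnd => Some None | Separator => Some (Some None)
  | Cell c => Some (Some (Some c))
  end.
Definition cell_decode (a : option (option (option C))) : tape_cell C :=
  match a with
  | None => LeftEnd | Some None => RightEnd | Some (Some None) => Separator
  | Some (Some (Some c)) => Cell c
  end.
Lemma cell_codeK : cancel cell_code cell_decode.
Proof. by case. Qed.
HB.instance Definition _ := Finite.copy (tape_cell C) (can_type cell_codeK).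
(** Separators and both end marks are read as the border [None] of a row. *)
Definition content (a : tape_cell C) : option C := if a is Cell c then Some c else None.
End TapeCell.

Section Tableau.

Variables (C : finType) (N : nat).
Variable vert : option C -> C -> option C -> C -> bool.
Variables (acc : pred C) (adj : rel (option C)) (wgt : pred C).

(** A space-time diagram with [vert] as local rule of radius one; columns 0 and [W.+1] are
    sentinels, and [wgt] marks the cells of the first row that are counted. *)
Record tableau (H W : nat) (T : nat -> nat -> option C) : Prop := Tableau {
  tableau_height : (1 < H)%N;
  tableau_border : forall r, (r < H)%N -> T r 0%N = None /\ T r W.+1 = None;
  tableau_first : forall j, (j <= W)%N -> adj (T 0%N j) (T 0%N j.+1);
  tableau_vert : forall r j, (r.+1 < H)%N -> (j < W)%N ->
    exists c d, [/\ T r j.+1 = Some c, T r.+1 j.+1 = Some d & vert (T r j) c (T r j.+2) d];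
  tableau_last : forall j, (j < W)%N -> exists2 c, T H.-1 j.+1 = Some c & acc c;
  tableau_count : (\sum_(j < W) oapp wgt false (T 0%N j.+1) = N)%N
}.

Local Notation window := (tape_cell C * tape_cell C * tape_cell C)%type.
Local Notation Z3 := (int * int * int)%type.
Local Notation vertex := (phase * Z3)%type.

(* On a tape [LeftEnd row Separator row ... row RightEnd], the same for both heads:
   [Compare] moves both heads right over equal cells; [Last] brings the first head
   back to the last separator, over accepting cells; [Check] moves both heads left,
   one row apart; [First] brings the second head back over the first row while the
   counter adds up [wgt]; [Jump] subtracts [N] from the counter. *)
Definition transition (q : phase) (a b : window) : option (phase * Z3) :=
  match q with
  | Compare => if a.1.2 == b.1.2 then
      match a.1.2 with
      | LeftEnd => None
      | RightEnd => Some (Last, (-1, 0, 0))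
      | _ => Some (Compare, (1, 1, 0))
      end else None
  | Last =>
      match a.1.2, b.1.2 with
      | Separator, RightEnd => Some (Check, (-1, -1, 0))
      | Cell c, RightEnd => if acc c then Some (Last, (-1, 0, 0)) else None
      | _, _ => None
      end
  | Check =>
      match a.1.2, b.1.2 with
      | LeftEnd, Separator =>
          if adj (content b.1.1) None then Some (First, (0, -1, 0)) else None
      | Separator, Separator => Some (Check, (-1, -1, 0))
      | Cell c, Cell d =>
          if vert (content a.1.1) c (content a.2) d then Some (Check, (-1, -1, 0)) else None
      | _, _ => None
      end
  | First =>
      match a.1.2, b.1.2 with
      | LeftEnd, LeftEnd => Some (Jump, (0, 0, 0))
      | LeftEnd, Cell c =>
          if adj (content b.1.1) (Some c) then Some (First, (0, -1, (wgt c : nat)%:Z)) else None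
      | _, _ => None
      end
  | Jump => Some (Restart, (0, 0, - N%:Z))
  | Restart => if (a.1.2 == LeftEnd) && (b.1.2 == LeftEnd) then Some (Compare, (1, 1, 0)) else None
  end.

Definition cells (y : int -> tape_cell C) (p : int) : window := (y (p - 1), y p, y (p + 1)).

Definition advance (X : bool -> int -> tape_cell C) (v : vertex) : option vertex :=
  omap (fun r => (r.1, v.2 + r.2))
    (transition v.1 (cells (X false) v.2.1.1) (cells (X true) v.2.1.2)).

Definition advances X n v : option vertex := iter n (obind (advance X)) (Some v).

(* Each phase entered from two others is entered on a cell that tells them apart, so
   the automaton is reversible. *)
Definition retreat (X : bool -> int -> tape_cell C) (v : vertex) : vertex :=
  match v.1 with
  | Compare => (if X false (v.2.1.1 - 1) == LeftEnd then Restart else Compare, v.2 - (1, 1, 0))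
  | Last => (if X false (v.2.1.1 + 1) == RightEnd then Compare else Last, v.2 + (1, 0, 0))
  | Check => (if X true (v.2.1.2 + 1) == RightEnd then Last else Check, v.2 + (1, 1, 0))
  | First =>
      if X true (v.2.1.2 + 1) is Cell c then (First, v.2 + (0, 1, - (wgt c : nat)%:Z))
      else (Check, v.2 + (0, 1, 0))
  | Jump => (First, v.2)
  | Restart => (Jump, v.2 + (0, 0, N%:Z))
  end.

Lemma advanceK X v t : advance X v = Some t -> retreat X t = v.
Proof.
case: v => q [[u1 u2] u3]; rewrite /advance /cells /=.
have sub3 (a b c a' b' c' : int) : (a, b, c) - (a', b', c') = (a - a', b - b', c - c') by [].
case: q => /=.
- case: eqP => // e; case E : (X false u1) => [|||c] //= [<-];
  by rewrite /retreat /= ?add3 ?sub3 ?addrK ?subrK ?E ?addr0 ?subr0.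
- case E : (X false u1) => [|||c] //=; case E2 : (X true u2) => [|||c'] //=;
  first (case=> <-; by rewrite /retreat /= ?add3 ?sub3 ?addrK ?subrK ?E2 ?addr0 ?subr0).
  by case: ifP => // _ [<-]; rewrite /retreat /= ?add3 ?sub3 ?addrK ?subrK ?E ?addr0 ?subr0.
- case E : (X false u1) => [|||c] //=; case E2 : (X true u2) => [|||c'] //=;
  try case: ifP => // _; case=> <-;
  by rewrite /retreat /= ?add3 ?sub3 ?addrK ?subrK ?E2 ?addr0 ?subr0 ?subrK.
- case E : (X false u1) => [|||c] //=; case E2 : (X true u2) => [|||c'] //=;
  try case: ifP => // _; case=> <-;
  by rewrite /retreat /= ?add3 ?sub3 ?addrK ?subrK ?E2 ?addr0 ?subr0 ?add3 ?subrK ?addrK ?addr0.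
- by case=> <-; rewrite /retreat /= ?add3 ?addr0 ?subrK.
- case: ifP => // /andP[/eqP E _] [<-].
  by rewrite /retreat /= ?add3 ?sub3 ?addrK ?E ?addr0 ?subr0.
Qed.

Lemma advance_inj X u u' t : advance X u = Some t -> advance X u' = Some t -> u = u'.
Proof. by move=> /advanceK <- /advanceK. Qed.

End Tableau.

(** * From a cycle of the automaton to a tableau *)

Section CycleTableau.

Variables (C : finType) (N : nat).
Variable vert : option C -> C -> option C -> C -> bool.
Variables (acc : pred C) (adj : rel (option C)) (wgt : pred C).
Local Notation tableau := (tableau N vert acc adj wgt).
Local Notation advance := (advance N vert acc adj wgt).
Local Notation advances := (advances N vert acc adj wgt).
Local Notation Z3 := (int * int * int)%type.
Local Notation vertex := (phase * Z3)%type.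

Section Trajectory.
(** What [Check] verifies with the first head on [b], between [a] and [c], and the second head on
    [d], one row further. *)
Definition linked (a b c d : tape_cell C) : Prop :=
  (b = Separator /\ d = Separator) \/
  (exists c' d', [/\ b = Cell c', d = Cell d' & vert (content a) c' (content c) d']).

Variables (X : bool -> int -> tape_cell C) (f : nat -> vertex).
Hypothesis f_next : forall j, advance X (f j) = Some (f j.+1).

Definition rank (v : vertex) : nat :=
  match v.1 with
  | Compare => 0 | Last => 1 | Check => 2 | First => 3 | Jump => 4 | Restart => 5
  end.

Definition progress (v : vertex) : int :=
  match v.1 with
  | Compare => v.2.1.1 | Last | Check => - v.2.1.1 | First => - v.2.1.2
  | Jump | Restart => 0
  end.

(** The pair of [rank] and [progress] increases lexicographically, so that no cycle can avoid
    [Restart]. *)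
Lemma advance_progress v t : v.1 <> Restart -> advance X v = Some t ->
  (rank v < rank t)%N \/ rank v = rank t /\ progress v < progress t.
Proof.
case: v => q [[u1 u2] u3]; rewrite /advance /cells /= => qR.
case: q qR => //= _.
- case: eqP => // e; case E : (X false u1) => [|||c] //= [<-]; rewrite /rank /progress /=;
  solve [by left | by right; split => //; lia].
- case E : (X false u1) => [|||c] //=; case E2 : (X true u2) => [|||c'] //=;
  try case: ifP => // _; case=> <-; rewrite /rank /progress /=;
  solve [by left | by right; split => //; lia].
- case E : (X false u1) => [|||c] //=; case E2 : (X true u2) => [|||c'] //=;
  try case: ifP => // _; case=> <-; rewrite /rank /progress /=;
  solve [by left | by right; split => //; lia].
- case E : (X false u1) => [|||c] //=; case E2 : (X true u2) => [|||c'] //=;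
  try case: ifP => // _; case=> <-; rewrite /rank /progress /=;
  solve [by left | by right; split => //; lia].
- by case=> <-; left.
Qed.

Variables (p : Z3).
Hypothesis f0 : f 0%N = (Restart, p).

Let x1 (i : nat) := X false (p.1.1 + i%:Z).
Let x2 (i : nat) := X true (p.1.2 + i%:Z).
Local Notation at_ q i j z := (q, (p.1.1 + i%:Z, p.1.2 + j%:Z, p.2 + z)).

Lemma restart_start : [/\ x1 0 = LeftEnd, x2 0 = LeftEnd & f 1%N = at_ Compare 1%N 1%N 0].
Proof.
have := f_next 0; rewrite f0 /advance /= /x1 /x2 !addr0.
case: ifP => // /andP[/eqP -> /eqP ->] [<-]; split=> //.
by case: (p) => [[? ?] ?] /=; rewrite add3 addr0.
Qed.

(** [Last] has no transition on the left end at 0, so the first head, walking left over accepting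
    cells, has to stop on a separator before. *)
Lemma last_phase t i e z : f t = at_ Last i e z -> exists s t', [/\ (0 < s <= i)%N,
  x1 s = Separator, f t' = at_ Check s.-1 e.-1 z &
  forall j, (s < j <= i)%N -> exists2 c, x1 j = Cell c & acc c] /\ (x2 e = RightEnd).
Proof.
have [a0 b0 _] := restart_start.
elim: i t => [|i IH] t ft.
  by have := f_next t; rewrite ft /advance /= -/(x1 0) -/(x2 e) a0.
have := f_next t; rewrite ft /advance /= -/(x1 i.+1) -/(x2 e).
case E : (x1 i.+1) => [|||c] //=; case E2 : (x2 e) => [|||d] //=.
  case=> fS; exists i.+1, t.+1; split => //; split => //; [by rewrite /= leqnn| |by move=> j; lia].
  rewrite -fS add3 !addr0; congr (_, (_, _, _)); first by lia.
  have : (0 < e)%N by rewrite lt0n; apply/eqP => e0; rewrite e0 b0 in E2.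
  by clear; lia.
case: ifP => // cacc [fS].
have [|s [t' [[h1 h2 h3 h4] h5]]] := IH t.+1.
  by rewrite -fS add3 !addr0; congr (_, (_, _, _)); lia.
exists s, t'; split=> //; split => //; first by lia.
move=> j jj; case: (eqVneq j i.+1) => [->|ne]; first by exists c.
by apply: h4; lia.
Qed.

(** The heads move in step, so their offset [D], the length of a row with its delimiter, is
    constant; when the first reaches the left end, the second stands on the separator closing the
    first row. *)
Lemma check_phase t i D z : (0 < D)%N -> f t = at_ Check i (i + D)%N z ->
  (forall j, (0 < j <= i)%N -> x1 j <> LeftEnd) ->
  exists t', [/\ f t' = at_ First 0%N D.-1 z, x2 D = Separator,
    adj (content (x2 D.-1)) None &
    forall j, (0 < j <= i)%N -> linked (x1 j.-1) (x1 j) (x1 j.+1) (x2 (j + D))].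
Proof.
move=> D0; have [a0 b0 _] := restart_start.
elim: i t => [|i IH] t ft notL.
  have := f_next t; rewrite ft /advance /= add0n -/(x1 0) -/(x2 D) a0.
  case E2 : (x2 D) => [|||d] //=; case: ifP => // ad [fS].
  exists t.+1; split => //; last by move=> j; lia.
    by rewrite -fS add3 !addr0; congr (_, (_, _, _)); lia.
  by move: ad; congr (adj (content _) _); rewrite /x2; congr (X _); lia.
have := f_next t; rewrite ft /advance /= -/(x1 i.+1) -/(x2 (i.+1 + D)).
have nL := notL i.+1 _.
have e0 : p.1.1 + i.+1%:Z - 1 = p.1.1 + i%:Z by lia.
have e2 : p.1.1 + i.+1%:Z + 1 = p.1.1 + i.+2%:Z by lia.
have IH' : f t.+1 = at_ Check i (i + D)%N z -> linked (x1 i) (x1 i.+1) (x1 i.+2) (x2 (i.+1 + D)) ->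
    exists t', [/\ f t' = at_ First 0%N D.-1 z, x2 D = Separator,
    adj (content (x2 D.-1)) None &
    forall j, (0 < j <= i.+1)%N -> linked (x1 j.-1) (x1 j) (x1 j.+1) (x2 (j + D))].
  move=> /IH[|t' [h1 h2 h3 h4] hl]; first by move=> j ij; apply: notL; lia.
  exists t'; split => // j ij; case: (eqVneq j i.+1) => [->//|ne].
  by apply: h4; lia.
case E : (x1 i.+1) => [|||c] //=; case E2 : (x2 (i.+1 + D)) => [|||d] //=.
- by exfalso; apply: nL => //; lia.
- case=> fS; apply: IH'; last by rewrite E E2; left.
  by rewrite -fS add3 !addr0; congr (_, (_, _, _)); lia.
- case: ifP => // v [fS]; apply: IH'.
    by rewrite -fS add3 !addr0; congr (_, (_, _, _)); lia.
  by rewrite E E2; right; exists c, d; split => //; rewrite /x1 -e0 -e2.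
Qed.

Lemma first_phase t k z : f t = at_ First 0%N k z ->
  (forall j, (0 < j <= k)%N -> x2 j <> LeftEnd) ->
  exists t', f t' = at_ Jump 0%N 0%N (z + (\sum_(j < k) oapp wgt false (content (x2 j.+1)))%N%:Z) /\
    forall j, (j < k)%N -> adj (content (x2 j)) (content (x2 j.+1)) /\ exists c, x2 j.+1 = Cell c.
Proof.
have [a0 b0 _] := restart_start.
elim: k t z => [|k IH] t z ft notL.
  have := f_next t; rewrite ft /advance /= -/(x1 0) -/(x2 0) a0 b0 => -[fS].
  exists t.+1; split => //.
  by rewrite -fS add3 big_ord0 !addr0.
have := f_next t; rewrite ft /advance /= -/(x1 0) -/(x2 k.+1) a0.
have nL := notL k.+1 _.
case E2 : (x2 k.+1) => [|||d] //=.
  by exfalso; apply: nL => //; lia.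
have -> : p.1.2 + k.+1%:Z - 1 = p.1.2 + k%:Z by lia.
rewrite -/(x2 k); case: ifP => // ad [fS].
have [|j jk|t' [h1 h2]] := IH t.+1 (z + (wgt d : nat)%:Z).
- by rewrite -fS add3 !addr0; congr (_, (_, _, _)); lia.
- by apply: notL; lia.
exists t'; split.
  by rewrite h1 big_ord_recr /= E2 /=; congr (_, (_, _, _)); lia.
move=> j jk; case: (eqVneq j k) => [->|ne]; last by apply: h2; lia.
by rewrite E2; split => //; exists d.
Qed.

Variable n : nat.
Hypothesis f_period : forall j, f (n + j)%N = f j.
Hypothesis n_gt0 : (0 < n)%N.

(** Without [Restart] the measure of [advance_progress] would increase strictly over a whole
    period. *)
Lemma trajectory_restart : exists j, (f j).1 = Restart.
Proof.
apply: contrapT => noR.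
suff H j : (0 < j)%N -> (rank (f 0%N) < rank (f j))%N \/
    rank (f 0%N) = rank (f j) /\ progress (f 0%N) < progress (f j).
  have := H n n_gt0; rewrite -[n]addn0 f_period ltnn ltxx; by case=> // -[].
case: j => // j _; elim: j => [|j IH].
  by apply: advance_progress => // e; apply: noR; exists 0%N.
have := advance_progress _ (f_next j.+1).
case=> [e|h|[h1 h2]]; first by apply: noR; exists j.+1.
  by left; case: IH => [h'|[-> _]//]; exact: ltn_trans h.
by case: IH => [h'|[h3 h4]]; [left; rewrite -h1|right; split; [rewrite h3|exact: lt_trans h2]].
Qed.

(** If the heads never met [RightEnd], the trajectory would stay in [Compare] and not return to
    [Restart] after [n] steps. *)
Lemma compare_phase : exists e t, [/\ (0 < e)%N, x1 e = RightEnd, x2 e = RightEnd,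
  f t = at_ Last e.-1 e 0 &
  forall i, (0 < i < e)%N -> [/\ x1 i = x2 i, x1 i <> LeftEnd & x1 i <> RightEnd]].
Proof.
apply: contrapT => no; have [a0 b0 f1] := restart_start.
suff H k : f k.+1 = at_ Compare k.+1 k.+1 0 /\
    forall i, (0 < i <= k)%N -> [/\ x1 i = x2 i, x1 i <> LeftEnd & x1 i <> RightEnd].
  have [] := H n.-1; rewrite prednK // => + _.
  by rewrite -[n in f n]addn0 f_period f0.
elim: k => [|k [fk IH]]; first by split => // i; lia.
have := f_next k.+1; rewrite fk /advance /= -/(x1 k.+1) -/(x2 k.+1).
case: eqP => // e; case E : (x1 k.+1) => [|||c] //= [fS].
- exfalso; apply: no; exists k.+1, k.+2; split => //; rewrite -?e //.
  by rewrite -fS add3 !addr0; congr (_, (_, _, _)); lia.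
- split.
    by rewrite -fS add3 !addr0; congr (_, (_, _, _)); lia.
  move=> i ik; case: (eqVneq i k.+1) => [->|ne]; first by rewrite -e E.
  by apply: IH; lia.
- split.
    by rewrite -fS add3 !addr0; congr (_, (_, _, _)); lia.
  move=> i ik; case: (eqVneq i k.+1) => [->|ne]; first by rewrite -e E.
  by apply: IH; lia.
Qed.

Definition raise (d : int) (v : vertex) : vertex := (v.1, (v.2.1.1, v.2.1.2, v.2.2 + d)).

Lemma advance_raise d v : advance X (raise d v) = omap (raise d) (advance X v).
Proof.
rewrite /advance /=; case: transition => //= -[q [[r1 r2] r3]] /=.
by case: v => ? [[? ?] ?]; rewrite /raise /= !add3 addrAC.
Qed.

(* The transitions ignore the counter, so each return to the same cells raises it by
   the same amount. *)
Lemma return_height T d : f T = at_ Restart 0%N 0%N d -> d = 0.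
Proof.
move=> fT; have f0' : f 0%N = at_ Restart 0%N 0%N 0 by rewrite f0 !addr0; case: (p) => [[]].
have shiftT j : f (T + j)%N = raise d (f j).
  elim: j => [|j IH]; first by rewrite addn0 fT f0' /raise /= !addr0.
  apply: Some_inj; rewrite addnS -!f_next IH advance_raise f_next //.
have mulT k : f (k * T)%N = raise (d *+ k) (f 0%N).
  elim: k => [|k IH]; first by rewrite f0' /raise /= !addr0.
  by rewrite mulSn shiftT IH /raise /= mulrSr !addrA.
have muln k : f (k * n)%N = f 0%N.
  by elim: k => // k IH; rewrite mulSn f_period.
have := mulT n; rewrite mulnC muln f0' /raise /= => -[] e.
have : d *+ n = 0 by lia.
by move/eqP; rewrite mulrn_eq0 => /orP[/eqP n0|/eqP//]; have := n_gt0; rewrite n0.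
Qed.

End Trajectory.
(** The point is that the delimiters form a grid: [linked] transports separators by [D] both ways,
    which forces [D] to divide [s] and [e]. *)
Lemma tableau_of_string (y : nat -> tape_cell C) (e s D : nat) :
  (0 < s < e)%N -> D = (e - s)%N ->
  y 0%N = LeftEnd -> y e = RightEnd -> y s = Separator -> y D = Separator ->
  (forall j, (s < j < e)%N -> exists2 c, y j = Cell c & acc c) ->
  (forall j, (0 < j < s)%N -> linked (y j.-1) (y j) (y j.+1) (y (j + D)%N)) ->
  (forall j, (j < D.-1)%N -> adj (content (y j)) (content (y j.+1)) /\ exists c, y j.+1 = Cell c) ->
  adj (content (y D.-1)) None ->
  (\sum_(j < D.-1) oapp wgt false (content (y j.+1)) = N)%N ->
  tableau (e %/ D) D.-1 (fun r j => content (y (r * D + j)%N)).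
Proof.
move=> hs hD y0 ye ys yD hacc hlink hfirst hadj hcount.
have D0 : (0 < D)%N by lia.
have sep_down j : (0 < j < s)%N -> y (j + D)%N = Separator -> y j = Separator.
  by move=> /hlink[[-> //]|[c [d [_ -> _]]]].
have sep_up j : (0 < j < s)%N -> y j = Separator -> y (j + D)%N = Separator.
  by move=> /hlink[[_ -> //]|[c [d [-> _ _]]]].
have down k : (k * D < s)%N -> y (s - k * D)%N = Separator.
  elim: k => [|k IH] hk; first by rewrite mul0n subn0.
  have kk : (k * D < s)%N by apply: leq_ltn_trans hk; rewrite leq_mul2r leqnSn orbT.
  apply: sep_down; rewrite ?mulSn ?mulSn in hk *; first by lia.
  by rewrite -IH //; congr y; lia.
(* Descending from [s] by [D] puts a separator at [s %% D]; were this nonzero, it would lie in the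
   first row, which holds only cells. *)
have sD : s = (s %/ D * D)%N.
  case: (posnP (s %% D)) => [m0|m0]; first by rewrite {1}(divn_eq s D) m0 addn0.
  have lt : (s %/ D * D < s)%N by rewrite {2}(divn_eq s D) -[X in (X < _)%N]addn0 ltn_add2l.
  have := down _ lt; rewrite {1}(divn_eq s D) addKn => ymod.
  have mD : (s %% D < D)%N by rewrite ltn_mod.
  have [|_ [c]] := hfirst (s %% D).-1; first by lia.
  by rewrite prednK // ymod.
set q := (s %/ D)%N in sD.
have q0 : (0 < q)%N by lia.
have eD : e = (q.+1 * D)%N by rewrite mulSn; lia.
have -> : (e %/ D)%N = q.+1 by rewrite eD mulnK.
have upS r : (0 < r <= q)%N -> y (r * D)%N = Separator.
  elim: r => // r IH hr; case: r => [|r] in IH hr *; first by rewrite mul1n.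
  rewrite mulSn addnC; apply: sep_up; last by apply: IH; lia.
  by rewrite sD muln_gt0 ltn_mul2r D0 /=; lia.
(* [linked] carries cells from each row to the next, starting from those crossed in phase
   [First]. *)
have cellr r j : (r <= q)%N -> (j < D.-1)%N -> exists c, y (r * D + j.+1)%N = Cell c.
  elim: r => [|r IH] hr hj; first by have [_] := hfirst j hj.
  have [c hc] := IH (ltnW hr) hj.
  have : (0 < r * D + j.+1 < s)%N.
    have : (r.+1 * D <= q * D)%N by rewrite leq_mul2r hr orbT.
    by rewrite mulSn; lia.
  move/hlink; rewrite hc => -[[//]|[c' [d [_ hd _]]]]; exists d.
  by rewrite -hd; congr y; rewrite mulSn; lia.
split.
- by [].
- move=> r hr; split.
    rewrite addn0; case: r hr => [|r] hr; first by rewrite mul0n y0.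
    by rewrite upS.
  rewrite prednK // -mulSnr; case: (eqVneq r q) => [->|ne]; first by rewrite -eD ye.
  by rewrite upS //; lia.
- move=> j hj; rewrite mul0n !add0n.
  move: hj; rewrite leq_eqVlt => /orP[/eqP ->|hj]; last by have [] := hfirst _ hj.
  by rewrite prednK // yD.
- move=> r j hr hj.
  have [c hc] := cellr r j (ltnW hr) hj.
  have : (0 < r * D + j.+1 < s)%N.
    have : (r.+1 * D <= q * D)%N by rewrite leq_mul2r -ltnS hr orbT.
    by rewrite mulSn; lia.
  move/hlink; rewrite hc => -[[//]|[c' [d [[<-] hd hv]]]]; exists c, d.
  split => //; first by have -> : (r.+1 * D + j.+1 = r * D + j.+1 + D)%N; [rewrite mulSn; lia|rewrite hd].
  by move: hv; rewrite addnS /= !addnS.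
- move=> j hj; have [|c hc ac] := hacc (q * D + j.+1)%N; first by rewrite -sD; lia.
  by exists c => //; rewrite hc.
- by rewrite -hcount; apply: eq_bigr.
Qed.

Theorem cycle_tableau X v n : (0 < n)%N -> advances X n v = Some v ->
  exists H W T, tableau H W T.
Proof.
move=> n0 rn; pose f j := odflt v (advances X j v).
have period j : advances X (j + n) v = advances X j v by rewrite /advances iterD -/(advances X n v) rn.
have periods k : advances X (k * n) v = Some v.
  by elim: k => // k IH; rewrite mulSn addnC period.
(* A run stuck after [j] steps would still be stuck after [j * n] steps, when it is back at [v]. *)
have fE j : advances X j v = Some (f j).
  rewrite /f; case e : (advances X j v) => //.
  suff : advances X (j * n) v = None by rewrite periods.
  have -> : (j * n = (j * n - j) + j)%N by rewrite subnK // leq_pmulr.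
  by rewrite /advances iterD -/(advances X j v) e; elim: (j * n - j)%N => //= k ->.
have fn j : advance X (f j) = Some (f j.+1) by rewrite -fE /advances iterS -/(advances X j v) fE.
have fp j : f (n + j)%N = f j by apply: Some_inj; rewrite -!fE addnC period.
have [j0 j0R] := trajectory_restart fn fp n0.
pose g j := f (j0 + j)%N.
have gn j : advance X (g j) = Some (g j.+1) by rewrite /g addnS fn.
have gp j : g (n + j)%N = g j by rewrite /g addnCA fp.
have [p g0] : exists p, g 0%N = (Restart, p).
  by exists (f j0).2; rewrite /g addn0 -j0R -surjective_pairing.
have [a0 b0 _] := restart_start gn g0.
have [e [t [e0 ae be gt mid]]] := compare_phase gn g0 gp n0.
have [s [t1 [[hs as_ gt1 hacc] _]]] := last_phase gn g0 gt.
pose D := (e - s)%N.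
have D0 : (0 < D)%N by rewrite /D; lia.
have eD : e.-1 = (s.-1 + D)%N by rewrite /D; lia.
rewrite eD in gt1.
have [|t2 [gt2 bD adjD link]] := check_phase gn g0 D0 gt1.
  by move=> j hj; have [|//] := mid j; lia.
(* By [Compare] the two tapes agree up to the right end, so a single string describes both. *)
have mid2 j : (j <= e)%N -> X true (p.1.2 + j%:Z) = X false (p.1.1 + j%:Z).
  case: j => [|j] je; first by rewrite a0 b0.
  move: je; rewrite leq_eqVlt => /orP[/eqP ->|je]; first by rewrite ae be.
  by have [|-> _ _] := mid j.+1.
have [|t3 [gt3 first]] := first_phase gn g0 gt2.
  by move=> j hj; rewrite mid2 ?/D; last lia; have [|//] := mid j; rewrite /D in hj; lia.
set K := (\sum_(j < D.-1) _)%N in gt3.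
have gt4 := gn t3; rewrite gt3 /advance /= in gt4; case: gt4 => gt4.
(* The heads are back on their starting cells in [Restart], so the net change of the counter is
   0. *)
have KN : K%:Z - N%:Z = 0.
  by apply: (return_height gn g0 gp n0 (T := t3.+1)); rewrite -gt4 add3 !addr0 add0r addrA.
exists (e %/ D)%N, D.-1, (fun r j => content (X false (p.1.1 + (r * D + j)%N%:Z))).
apply: (@tableau_of_string (fun j => X false (p.1.1 + j%:Z)) e s) => //.
- by lia.
- by rewrite -mid2 // /D; lia.
- by move=> j hj; apply: hacc; lia.
- move=> j hj; rewrite -[X in linked _ _ _ X]mid2; last by rewrite /D; lia.
  by apply: link; lia.
- move=> j hj; have := first j hj; rewrite !mid2 //; rewrite /D in hj; lia.
- by move: adjD; rewrite mid2 // /D; lia.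
- transitivity K; last by lia.
  by apply: eq_bigr => j _; rewrite mid2 //; have := ltn_ord j; rewrite /D; lia.
Qed.

End CycleTableau.

(** * From a tableau to a cycle of the automaton *)

Section TableauCycle.

Variables (C : finType) (N : nat).
Variable vert : option C -> C -> option C -> C -> bool.
Variables (acc : pred C) (adj : rel (option C)) (wgt : pred C).
Local Notation tableau := (tableau N vert acc adj wgt).
Local Notation advance := (advance N vert acc adj wgt).
Local Notation advances := (advances N vert acc adj wgt).
Local Notation Z3 := (int * int * int)%type.
Local Notation vertex := (phase * Z3)%type.

Variables (H W : nat) (T : nat -> nat -> option C).
Hypothesis tab : tableau H W T.
Local Notation D := W.+1.
Local Notation e := (H * D)%N.
Local Notation s := (H.-1 * D)%N.

Definition string_of (i : nat) : tape_cell C :=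
  if i == 0%N then LeftEnd else if i == e then RightEnd
  else if (D %| i)%N then Separator
  else if T (i %/ D) (i %% D) is Some c then Cell c else Separator.

Definition tape_of (_ : bool) (i : int) : tape_cell C :=
  if i is Posz m then string_of m else LeftEnd.

Local Notation y := string_of.
Local Notation X := tape_of.

Let H1 : (1 < H)%N := tableau_height tab.

Lemma eE : e = (s + D)%N.
Proof. by rewrite -mulSnr; case: H H1. Qed.

Lemma string_sep r : (0 < r < H)%N -> y (r * D) = Separator.
Proof.
case/andP=> r0 rH; rewrite /string_of dvdn_mull // muln_eq0 /= orbF eqn_mul2r /=.
by rewrite (gtn_eqF r0) (ltn_eqF rH).
Qed.

Lemma string_end : y e = RightEnd.
Proof. by rewrite /string_of eqxx muln_eq0; case: H H1. Qed.

Lemma tableau_cell r j : (r < H)%N -> (j < W)%N -> exists c, T r j.+1 = Some c.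
Proof.
move=> rH jW; case: (ltnP r.+1 H) => rH1.
  by have [c [d [-> _ _]]] := tableau_vert tab rH1 jW; exists c.
have -> : r = H.-1 by lia.
by have [c -> _] := tableau_last tab jW; exists c.
Qed.

Lemma string_cell r j : (r < H)%N -> (j < W)%N -> exists2 c, y (r * D + j.+1)%N = Cell c & T r j.+1 = Some c.
Proof.
move=> rH jW; have [c hc] := tableau_cell rH jW; exists c => //.
have lt : (r * D + j.+1 < e)%N.
  have : (r.+1 * D <= e)%N by rewrite leq_mul2r rH orbT.
  by rewrite mulSn; lia.
rewrite /string_of addnS /= -addnS (ltn_eqF lt) dvdn_addr ?dvdn_mull //.
have -> : (D %| j.+1)%N = false by apply/negP => /dvdn_leq; lia.
by rewrite divnMDl // divn_small ?addn0 // modnMDl modn_small // hc.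
Qed.

Lemma content_string r j : (r < H)%N -> (j <= W.+1)%N -> content (y (r * D + j)%N) = T r j.
Proof.
move=> rH; have [b0 b1] := tableau_border tab rH.
case: j => [|j].
  rewrite addn0 b0 => _; case: (posnP r) => [->|r0]; first by rewrite mul0n.
  by rewrite string_sep // r0.
rewrite ltnS leq_eqVlt => /orP[/eqP ->|jW]; last by have [c -> ->] := string_cell rH jW.
rewrite b1 -mulSnr; move: rH; rewrite leq_eqVlt => /orP[/eqP ->|rH]; first by rewrite string_end.
by rewrite string_sep.
Qed.

Lemma string_middle i : (0 < i < e)%N -> y i <> LeftEnd /\ y i <> RightEnd.
Proof.
case/andP=> i0 ie; rewrite /string_of (gtn_eqF i0) (ltn_eqF ie).
by case: ifP => // _; case: (T _ _).
Qed.

Definition reaches (u v : vertex) := exists n, advances X n u = Some v.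

Lemma reaches_refl v : reaches v v. Proof. by exists 0%N. Qed.

Lemma reaches_step u v t : advance X u = Some v -> reaches v t -> reaches u t.
Proof. by move=> h [n hn]; exists n.+1; rewrite /advances iterSr /= h. Qed.

Lemma reaches_trans u v t : reaches u v -> reaches v t -> reaches u t.
Proof.
move=> [m hm] [n hn]; exists (n + m)%N.
by rewrite /advances iterD -/(advances X m u) hm.
Qed.

Local Notation at_ q i j z := ((q, (i%:Z, j%:Z, z)) : vertex).

Lemma cells_tape c i : cells (X c) i%:Z = (if i is k.+1 then y k else LeftEnd, y i, y i.+1).
Proof.
rewrite /cells; congr (_, _, _).
  by case: i => [|i] //; have -> : i.+1%:Z - 1 = i%:Z by lia.
by have -> : i%:Z + 1 = i.+1%:Z by lia.
Qed.

Lemma advance_tape q i j z : advance X (at_ q i j z) =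
  omap (fun r => (r.1, (i%:Z, j%:Z, z) + r.2))
    (transition N vert acc adj wgt q (if i is k.+1 then y k else LeftEnd, y i, y i.+1)
                        (if j is k.+1 then y k else LeftEnd, y j, y j.+1)).
Proof. by rewrite /advance !cells_tape. Qed.

Lemma at_eq q (i j z i' j' z' : int) : i = i' -> j = j' -> z = z' ->
  Some ((q, (i, j, z)) : vertex) = Some (q, (i', j', z')).
Proof. by move=> -> -> ->. Qed.

Lemma reaches_compare i : (i < e)%N -> reaches (at_ Compare 1%N 1%N 0) (at_ Compare i.+1 i.+1 0).
Proof.
elim: i => [|i IH] ie; first exact: reaches_refl.
apply: reaches_trans (IH (ltnW ie)) _; apply: reaches_step (reaches_refl _).
have [h1 h2] := @string_middle i.+1 ie.
rewrite advance_tape /= eqxx; case: (y i.+1) h1 h2 => [|||c] //= _ _;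
by rewrite add3; apply: at_eq; lia.
Qed.

Lemma reaches_last k : (k <= W)%N -> reaches (at_ Last e.-1 e 0) (at_ Last (e.-1 - k)%N e 0).
Proof.
elim: k => [|k IH] kW; first by rewrite subn0; exact: reaches_refl.
apply: reaches_trans (IH (ltnW kW)) _; apply: reaches_step (reaches_refl _).
have jW : (W - k.+1 < W)%N by lia.
have [c hc ac] := tableau_last tab jW.
have rH : (H.-1 < H)%N by lia.
have [c' yc Tc] := string_cell rH jW.
have E : (e.-1 - k = s + (W - k.+1).+1)%N by rewrite eE; move: s => a; lia.
rewrite advance_tape /= string_end E yc /=; move: hc; rewrite Tc => -[->]; rewrite ac /=.
by rewrite add3 (subnS e.-1 k) E; move: (s) => a; apply: at_eq; lia.
Qed.

Lemma reaches_check i : (i < s)%N -> reaches (at_ Check i (i + D)%N 0) (at_ Check 0%N D 0).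
Proof.
elim: i => [|i IH] hi; first by rewrite add0n; exact: reaches_refl.
apply: reaches_step (IH (ltnW hi)); rewrite advance_tape.
have rH : ((i.+1 %/ D).+1 < H)%N.
  have : (i.+1 %/ D < H.-1)%N by rewrite ltn_divLR.
  by lia.
(* Row and column of the first head; the second head is in the same column of the next row. *)
have iE := divn_eq i.+1 D; set r := (i.+1 %/ D)%N in iE rH.
have mD : (i.+1 %% D < D)%N by rewrite ltn_mod.
case: (posnP (i.+1 %% D)%N) => [m0|m0].
  rewrite m0 addn0 in iE.
  have r0 : (0 < r)%N by case: (r) iE.
  have yi : y i.+1 = Separator by rewrite iE string_sep //; lia.
  have yd : y (i.+1 + D)%N = Separator by rewrite iE -mulSnr string_sep.
  by rewrite yi yd /= add3; apply: at_eq; lia.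
have jW : ((i.+1 %% D).-1 < W)%N by lia.
have [c [d [Tc Td v]]] := tableau_vert tab rH jW.
have [c' yc Tc'] := string_cell (ltnW rH) jW.
have [d' yd Td'] := string_cell rH jW.
rewrite prednK // in yc yd v Tc Tc' Td Td'.
rewrite Tc in Tc'; case: Tc' => Tc'; rewrite Td in Td'; case: Td' => Td'.
rewrite -iE in yc.
have {}yd : y (i.+1 + D)%N = Cell d' by rewrite -yd; congr y; rewrite mulSn; lia.
have yl : content (y i) = T r (i.+1 %% D).-1.
  rewrite -(content_string (ltnW rH)); last by rewrite (leq_trans (ltnW jW)).
  by congr (content (y _)); lia.
have yr : content (y i.+2) = T r (i.+1 %% D).+1.
  by rewrite -(content_string (ltnW rH)) // addnS -iE.
rewrite yc yd /= yl yr -Tc' -Td' v /= add3; apply: at_eq; lia.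
Qed.

Lemma reaches_first k z : (k <= W)%N ->
  reaches (at_ First 0%N k z) (at_ First 0%N 0%N (z + (\sum_(j < k) oapp wgt false (T 0%N j.+1))%N%:Z)).
Proof.
elim: k z => [|k IH] z kW; first by rewrite big_ord0 addr0; exact: reaches_refl.
have [c hc Tc] := @string_cell 0%N k (ltnW H1) kW.
apply: reaches_step (reaches_trans (IH (z + (wgt c : nat)%:Z) (ltnW kW)) _).
  rewrite advance_tape /=.
  rewrite mul0n add0n in hc; rewrite hc /=.
  have := @content_string 0%N k (ltnW H1) (leqW (ltnW kW)).
  rewrite mul0n add0n => ->.
  have := tableau_first tab (ltnW kW); rewrite Tc => -> /=.
  by rewrite add3; apply: at_eq; lia.
have -> : z + (wgt c : nat)%:Z + (\sum_(j < k) oapp wgt false (T 0%N j.+1))%N%:Z =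
   z + (\sum_(j < k.+1) oapp wgt false (T 0%N j.+1))%N%:Z.
  by rewrite big_ord_recr /= Tc /=; lia.
exact: reaches_refl.
Qed.

Theorem tableau_cycle : exists n, (0 < n)%N /\ advances X n (Restart, 0) = Some (Restart, 0).
Proof.
suff [n hn] : reaches (at_ Compare 1%N 1%N 0) (at_ Restart 0%N 0%N 0).
  by exists n.+1; split => //; rewrite /advances iterSr.
have e0 : (0 < e)%N by rewrite eE; lia.
have s0 : (0 < s)%N by rewrite muln_gt0; lia.
have eD := eE.
have h1 := @reaches_compare e.-1 ltac:(lia); rewrite prednK // in h1.
apply: reaches_trans h1 _.
apply: (@reaches_step _ (at_ Last e.-1 e 0)).
  by rewrite advance_tape /= eqxx string_end /= add3; apply: at_eq; lia.
apply: reaches_trans (reaches_last (leqnn W)) _.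
have -> : (e.-1 - W = s)%N by lia.
apply: (@reaches_step _ (at_ Check s.-1 (s.-1 + D)%N 0)).
  rewrite advance_tape /= string_sep; last by lia.
  by rewrite string_end /= add3; apply: at_eq; lia.
apply: reaches_trans (@reaches_check s.-1 ltac:(lia)) _.
apply: (@reaches_step _ (at_ First 0%N W 0)).
  have yD := @string_sep 1%N; rewrite mul1n in yD.
  rewrite advance_tape /= yD; last by lia.
  have := @content_string 0%N W (ltnW H1) (leqnSn _); rewrite mul0n add0n /= => ->.
  have [_ b1] := tableau_border tab (ltnW H1).
  have := tableau_first tab (leqnn W); rewrite b1 => -> /=.
  by rewrite add3; apply: at_eq; lia.
apply: reaches_trans (reaches_first 0 (leqnn W)) _.
(* The counter now equals [N], which the jump takes back to 0. *)
rewrite (tableau_count tab).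
apply: (@reaches_step _ (at_ Jump 0%N 0%N (0 + N%:Z))).
  by rewrite advance_tape /= add3; apply: at_eq; lia.
apply: reaches_step (reaches_refl _).
by rewrite advance_tape /= add3; apply: at_eq; lia.
Qed.

End TableauCycle.

(** * From cells to blocks of bits *)

Section Blocks.

Variables (Q G : finType) (g0 : G).
Variable tr : Q -> G * G * G -> G * G * G -> option (Q * (int * int * int)).
Local Notation B := #|G|.
Local Notation Z3 := (int * int * int)%type.
Local Notation vertex := (Q * Z3)%type.

Definition walk (X : bool -> int -> G) (v : vertex) : option vertex :=
  omap (fun r => (r.1, v.2 + r.2))
    (tr v.1 (X false (v.2.1.1 - 1), X false v.2.1.1, X false (v.2.1.1 + 1))
            (X true (v.2.1.2 - 1), X true v.2.1.2, X true (v.2.1.2 + 1))).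

Definition walks X n v : option vertex := iter n (obind (walk X)) (Some v).

(** Codewords are one-hot, but decoding is total: arbitrary bit tapes must be read as tapes of
    cells. *)
Definition decode_block (f : nat -> bool) : G := odflt g0 [pick g | f (enum_rank g)].

Definition encode_block (g : G) (i : nat) : bool := i == enum_rank g.

Lemma encode_blockK : cancel encode_block decode_block.
Proof.
move=> g; rewrite /decode_block /encode_block; case: pickP => [h /eqP/val_inj/enum_rank_inj //|/(_ g)].
by rewrite eqxx.
Qed.

Lemma eq_decode_block f f' : (forall i, (i < B)%N -> f i = f' i) -> decode_block f = decode_block f'.
Proof.
move=> e; rewrite /decode_block; congr odflt; apply: eq_pick => g /=.
by rewrite e // ltn_ord.
Qed.

Definition block (a : {ffun bool * 'I_(3 * B) -> bool}) (c : bool) (k : nat) : G :=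
  decode_block (fun i => oapp (fun j => a (c, j)) false (insub (k * B + i)%N)).

Definition spread (r : Q * Z3) : vertex := (r.1, (r.2.1.1 * B%:Z, r.2.1.2 * B%:Z, r.2.2)).

Definition bit_transition (q : Q) (a : {ffun bool * 'I_(3 * B) -> bool}) : option vertex :=
  omap spread (tr q (block a false 0, block a false 1, block a false 2)
                    (block a true 0, block a true 1, block a true 2)).

Definition block_tape (o : Z3) (x : bool -> int -> bool) (c : bool) (p : int) : G :=
  decode_block (fun i => x c ((if c then o.1.2 else o.1.1) + p * B%:Z + i%:Z)).

(** A window of three blocks starts at the left neighbour of the current cell, hence the [- 1]; [o]
    is the origin of the block grid. *)
Definition place (o : Z3) (v : vertex) : vertex :=
  (v.1, (o.1.1 + (v.2.1.1 - 1) * B%:Z, o.1.2 + (v.2.1.2 - 1) * B%:Z, o.2 + v.2.2)).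

Lemma vnext_place o x v :
  vnext bit_transition x (place o v) = omap (place o) (walk (block_tape o x) v).
Proof.
rewrite /vnext /walk /bit_transition /place /=.
have blk c k : (k < 3)%N -> block (read (3 * B) x
      (o.1.1 + (v.2.1.1 - 1) * B%:Z, o.1.2 + (v.2.1.2 - 1) * B%:Z, o.2 + v.2.2)) c k =
    block_tape o x c ((if c then v.2.1.2 else v.2.1.1) - 1 + k%:Z).
  move=> k3; apply: eq_decode_block => i iB.
  have lt : (k * B + i < 3 * B)%N.
    by apply: (@leq_trans (k.+1 * B)); [rewrite mulSn addnC ltn_add2r|rewrite leq_mul2r k3 orbT].
  rewrite insubT /= ffunE /=; congr (x c _); case: c; rewrite mulrDl /=; lia.
have e (z : int) : z - 1 + 1%N%:Z = z by lia.
have e2 (z : int) : z - 1 + 2%N%:Z = z + 1 by lia.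
rewrite !blk // !addr0 !e !e2.
case: tr => //= r; congr (Some (_, _)); rewrite add3; congr (_, _, _); lia.
Qed.

Lemma vrun_place o x n v :
  vrun bit_transition x n (place o v) = omap (place o) (walks (block_tape o x) n v).
Proof.
elim: n => [|n IH] //; rewrite runS IH /walks iterS -/(walks _ n v).
by case: (walks _ n v) => //= u; rewrite vnext_place.
Qed.

Lemma card_G : (0 < B)%N. Proof. by apply/card_gt0P; exists g0. Qed.

Lemma place_inj o : injective (place o).
Proof.
move=> [q [[u1 u2] u3]] [q' [[v1 v2] v3]] [-> /addrI e1 /addrI e2 /addrI ->].
have B0 : B%:Z != 0 by have := card_G; lia.
by move: (mulIf B0 e1) (mulIf B0 e2) => /addIr -> /addIr ->.
Qed.

(** The origin of the grid is free, so an orbit starting at any bit is a cell orbit for a suitable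
    grid and alignment need not be enforced. *)
Lemma place_base (v : vertex) : exists o, v = place o (v.1, 0).
Proof.
exists (v.2.1.1 + B%:Z, v.2.1.2 + B%:Z, v.2.2); case: v => q [[a b] c].
by rewrite /place /=; congr (_, (_, _, _)); lia.
Qed.

Lemma bit_acyclic : (forall X n v, (0 < n)%N -> walks X n v <> Some v) ->
  forall x n v, (0 < n)%N -> vrun bit_transition x n v <> Some v.
Proof.
move=> h x n v n0; have [o ->] := place_base v; rewrite vrun_place => e.
apply: (h (block_tape o x) n (v.1, 0) n0); move: e.
by case: walks => //= u /Some_inj/place_inj ->.
Qed.

Lemma bit_injective : (forall X u u' t, walk X u = Some t -> walk X u' = Some t -> u = u') ->
  forall x u u' t, vnext bit_transition x u = Some t -> vnext bit_transition x u' = Some t -> u = u'.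
Proof.
move=> h x u u' t eu eu'; have [o uo] := place_base u.
(* Displacements are multiples of the block length, so two predecessors of one vertex lie on the
   same grid. *)
have [v' uo'] : exists v', u' = place o v'.
  move: eu eu'; rewrite /vnext /bit_transition.
  case: tr => //= r [et]; case: tr => //= r' [et'].
  move: et; rewrite -et' => -[_ e1 e2 e3].
  exists (u'.1, (r.2.1.1 - r'.2.1.1, r.2.1.2 - r'.2.1.2, r.2.2 - r'.2.2)).
  move: e1 e2 e3; rewrite uo /place /=; case: u' {et' uo} => q [[a b] c] /=.
  by move=> e1 e2 e3; congr (_, (_, _, _)); lia.
rewrite uo' in eu' *; rewrite {1}uo in eu *; rewrite uo; congr (place o _).
move: eu eu'; rewrite !vnext_place.
case e1 : walk => [w|] //= [ew]; case e2 : walk => [w'|] //= [ew'].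
apply: (h _ _ _ _ e1); rewrite e2; congr Some; apply: (@place_inj o).
by rewrite ew ew'.
Qed.

Lemma bit_tape X : exists x, block_tape 0 x = X.
Proof.
exists (fun c i => encode_block (X c (i %/ B)%Z) `|(i %% B)%Z|%N).
apply/funext => c; apply/funext => p; rewrite -[RHS]encode_blockK.
apply: eq_decode_block => i iB.
have -> : (if c then (0 : Z3).1.2 else (0 : Z3).1.1) + p * B%:Z + i%:Z = p * B%:Z + i%:Z.
  by case: c; rewrite /= add0r.
rewrite divzMDl; last by have := card_G; lia.
rewrite divz_small ?addr0; last by have := card_G; lia.
by rewrite modzMDl modz_small //; lia.
Qed.

Lemma bit_cycle X n v : walks X n v = Some v -> exists x u, vrun bit_transition x n u = Some u.
Proof.
have [x <-] := bit_tape X => e; exists x, (place 0 v).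
by rewrite vrun_place e.
Qed.

End Blocks.

(** * Tableaux of a Turing machine with a counter *)

(** Roles of the columns in the first row: padding, first letter of the prefix, its other letters,
    and the position inside a copy of the repeated block. *)
Inductive zone (S : Type) (l : nat) :=
  LeftPad | RightPad | Lead of S | Body of S | Block of 'I_l.
Arguments LeftPad {S l}.
Arguments RightPad {S l}.
Arguments Lead {S l}.
Arguments Body {S l}.
Arguments Block {S l}.

Section Zone.
Variables (S : finType) (l : nat).
Definition zone_code (z : zone S l) : option (option (S + S + 'I_l)) :=
  match z with
  | LeftPad => None | RightPad => Some None | Lead a => Some (Some (inl (inl a)))
  | Body a => Some (Some (inl (inr a))) | Block k => Some (Some (inr k))
  end.
Definition zone_decode (z : option (option (S + S + 'I_l))) : zone S l :=
  match z with
  | None => LeftPad | Some None => RightPad | Some (Some (inl (inl a))) => Lead a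
  | Some (Some (inl (inr a))) => Body a | Some (Some (inr k)) => Block k
  end.
Lemma zone_codeK : cancel zone_code zone_decode.
Proof. by case. Qed.
HB.instance Definition _ := Finite.copy (zone S l) (can_type zone_codeK).
End Zone.

Section Machine.

Variables (S : finType) (M : TM S) (wt : seq S) (a0 : S).
Local Notation base := #|S|.+1.
Local Notation zone := (zone S (size wt)).

(** Digits start at 1, so that [numeral] is injective on words of all lengths. *)
Definition digit (a : S) : 'I_base := lift ord0 (enum_rank a).

Definition numeral (p : seq S) : nat := foldl (fun v a => v * base + digit a)%N 0%N p.

Definition dyn : finType :=
  (option (S + aux M) * option (state M) * option 'I_base * bool)%type.
Definition tape_part (d : dyn) : tape_symbol M := d.1.1.1.
Definition head_part (d : dyn) : option (state M) := d.1.1.2.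
Definition digit_part (d : dyn) : option 'I_base := d.1.2.
Definition token_part (d : dyn) : bool := d.2.
Definition Dyn (a : tape_symbol M) (q : option (state M)) (g : option 'I_base) (t : bool) : dyn :=
  (a, q, g, t).

Definition action (d : dyn) : option (state M * option (S + aux M) * move) :=
  if head_part d is Some q then
    if verdict q is None then Some (trans q (tape_part d)) else None
  else None.

Definition new_tape (d : dyn) := if action d is Some r then r.1.2 else tape_part d.

(** A head whose state has a verdict stays where it is, so rows repeat the halted configuration. *)
Definition new_head (l : option dyn) (d : dyn) (r : option dyn) : option (state M) :=
  if head_part d is Some q then
    if action d is Some (q', _, mv) then (if mv is Stay then Some q' else None) else Some q
  else if obind action l is Some (q', _, Right) then Some q'
  else if obind action r is Some (q', _, Left) then Some q'
  else None.

(* A token travels left and is absorbed by the first nonzero digit it meets, which it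
   decrements; the zeros it crosses become [base - 1], and columns without a digit
   let it pass. *)
Definition emits (g : option 'I_base) (t : bool) : bool :=
  t && (if g is Some i then i == ord0 else true).

Definition new_digit (g : option 'I_base) (t : bool) : option 'I_base :=
  if t then omap (fun i : 'I_base => if i == ord0 then ord_max else inord i.-1) g else g.

Definition emits_part d := emits (digit_part d) (token_part d).

Definition exits_left (d : dyn) : bool :=
  emits_part d || (if action d is Some (_, _, Left) then true else false).
Definition exits_right (d : dyn) : bool :=
  if action d is Some (_, _, Right) then true else false.

(** No row follows once the head or a token would cross the border: this conserves the counter and
    confines the head. *)
Definition local_rule (l : option dyn) (d : dyn) (r : option dyn) : option dyn :=
  if (~~ isSome l && exits_left d) || (~~ isSome r && exits_right d) then None
  else Some (Dyn (new_tape d) (new_head l d r) (new_digit (digit_part d) (token_part d))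
                 (oapp emits_part false r)).

(** Zones can occur only in the first row: [adjacent] demands them there, and [vertical] excludes
    them below. *)
Definition cell : finType := (zone + dyn)%type.

(** The counter starts with the numeral of the prefix, preceded by zeros, and each copy of the block
    launches one token from its first cell. *)
Definition start_of (z : zone) : dyn :=
  match z with
  | LeftPad => Dyn None None (Some ord0) false
  | RightPad => Dyn None None None false
  | Lead a => Dyn (Some (inl a)) (Some (start M)) (Some (digit a)) false
  | Body a => Dyn (Some (inl a)) None (Some (digit a)) false
  | Block k => Dyn (Some (inl (nth a0 wt k))) None None (k == 0%N :> nat)
  end.

Definition value (c : cell) : dyn := match c with inl z => start_of z | inr d => d end.

Definition vertical (l : option cell) (c : cell) (r : option cell) (c' : cell) : bool :=
  if c' is inr d then local_rule (omap value l) (value c) (omap value r) == Some d else false.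

Definition accepting (c : cell) : bool :=
  if c is inr d then
    [&& (if head_part d is Some q then verdict q == Some true else true),
        (if digit_part d is Some i then i == ord0 else true) & ~~ token_part d]
  else false.

(** Between the borders this forces left padding, one [Lead], some [Body], complete copies of the
    block, and right padding. *)
Definition adjacent_zones (y z : zone) : bool :=
  match y, z with
  | LeftPad, (LeftPad | Lead _) => true
  | (Lead _ | Body _), (Body _ | RightPad) => true
  | (Lead _ | Body _), Block k => k == 0%N :> nat
  | Block k, Block k' => (k' == k.+1 :> nat) || (k.+1 == size wt) && (k' == 0%N :> nat)
  | Block k, RightPad => k.+1 == size wt
  | RightPad, RightPad => true
  | _, _ => false
  end.

Definition adjacent (c d : option cell) : bool :=
  match c, d with
  | None, Some (inl LeftPad) => true
  | Some (inl y), Some (inl z) => adjacent_zones y z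
  | Some (inl RightPad), None => true
  | _, _ => false
  end.

Definition block_start (c : cell) : bool :=
  if c is inl (Block k) then k == 0%N :> nat else false.

Section Rows.
Variables (W o : nat).

Definition settle (c : config M) : config M :=
  if verdict (cstate c) is Some _ then c else step c.

Definition machine_row (c : config M) (g : nat -> option 'I_base) (t : nat -> bool) (j : nat) : dyn :=
  Dyn (ctape c (j%:Z - o%:Z)) (if chead c == j%:Z - o%:Z then Some (cstate c) else None) (g j) (t j).

Definition next_digits (g : nat -> option 'I_base) (t : nat -> bool) (j : nat) :=
  new_digit (g j) (t j).
Definition next_tokens (g : nat -> option 'I_base) (t : nat -> bool) (j : nat) :=
  (j.+1 < W)%N && emits (g j.+1) (t j.+1).

Definition left_of (R : nat -> dyn) (j : nat) := if j is i.+1 then Some (R i) else None.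
Definition right_of (R : nat -> dyn) (j : nat) := if (j.+1 < W)%N then Some (R j.+1) else None.

(** Only column [h] has an action, so it suffices to compare [j] with [h] and its two neighbours;
    digits and tokens evolve independently of the machine. *)
Lemma local_ruleE c g t j h : (j < W)%N -> (h < W)%N -> chead c = h%:Z - o%:Z ->
  local_rule (left_of (machine_row c g t) j) (machine_row c g t j) (right_of (machine_row c g t) j) =
  if ((j == 0%N) && exits_left (machine_row c g t j)) || ((j.+1 == W) && exits_right (machine_row c g t j))
  then None else Some (machine_row (settle c) (next_digits g t) (next_tokens g t) j).
Proof.
move=> jW hW hc; rewrite /local_rule.
have -> : ~~ isSome (left_of (machine_row c g t) j) = (j == 0%N) by case: j jW.
have -> : ~~ isSome (right_of (machine_row c g t) j) = (j.+1 == W).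
  by rewrite /right_of; case: ltnP => /=; lia.
case: ifP => // _; congr Some.
have headE i : (chead c == i%:Z - o%:Z) = (i == h) by rewrite hc; lia.
rewrite [RHS]/machine_row; congr Dyn.
- rewrite /new_tape /action /head_part /machine_row /= headE /settle.
  case: eqVneq => [jh|jh]; last first.
    case: verdict => //; rewrite /step.
    case: trans => -[q a] d /=; rewrite eq_sym headE (negPf jh) //.
  case: verdict => //; rewrite /step /tape_part /=.
  have -> : chead c = j%:Z - o%:Z by rewrite hc jh.
  by case: trans => -[q a] d /=; rewrite eqxx.
- have actE i : action (machine_row c g t i) = if i == h then
      (if verdict (cstate c) is None then Some (trans (cstate c) (ctape c (chead c))) else None) else None.
    rewrite /action /head_part /machine_row /= headE; case: eqVneq => // ->.
    by rewrite /tape_part /= hc.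
  rewrite /new_head actE /head_part [_.1.1.2]/= headE.
  have lE : obind action (left_of (machine_row c g t) j) = if j == h.+1 then
      (if verdict (cstate c) is None then Some (trans (cstate c) (ctape c (chead c))) else None) else None.
    by case: j {jW} => [|j] //=; rewrite actE.
  have rE : obind action (right_of (machine_row c g t) j) = if j.+1 == h then
      (if verdict (cstate c) is None then Some (trans (cstate c) (ctape c (chead c))) else None) else None.
    rewrite /right_of; case: ltnP => jW'; first exact: actE.
    by case: eqP => // jh; lia.
  rewrite lE rE /settle; case V : (verdict (cstate c)) => [b|].
    by rewrite headE; case: (j == h); case: (j == h.+1); case: (j.+1 == h).
  rewrite /step; case: trans => -[q a] d /=.
  rewrite hc.
  case: (eqVneq j h) => [->|ne1].
    case: d => /=; case: eqP => //; lia.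
  case: (eqVneq j h.+1) => [->|ne2].
    have -> : (h.+2 == h) = false by lia.
    case: d => /=; case: eqP => //; lia.
  case: (eqVneq j.+1 h) => [eh|ne3]; case: d => /=; case: eqP => //; lia.
- rewrite /right_of /next_tokens; case: ltnP => //.
Qed.

End Rows.
End Machine.

(** * Numerals, shape of the first row and conservation of the counter *)

Section Sound.

Variables (S : finType) (M : TM S) (wt : seq S) (a0 : S).
Local Notation base := #|S|.+1.
Local Notation zone := (zone S (size wt)).
Local Notation start_of := (@start_of S M wt a0).
Local Notation machine_row := (@machine_row S M).

Lemma numeral_inj : injective (@numeral S).
Proof.
have rc (p : seq S) a : numeral (rcons p a) = (numeral p * base + digit a)%N by rewrite /numeral foldl_rcons.
have d0 (a : S) : (0 < digit a < base)%N by rewrite ltn_ord lift0.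
have n0 : numeral ([::] : seq S) = 0%N by [].
move=> p; elim/last_ind: p => [|p a IH]; case/lastP => [|q b] //; rewrite ?rc.
- have := d0 b; rewrite n0; move: (numeral q * base)%N => u; lia.
- have := d0 a; rewrite n0; move: (numeral p * base)%N => u; lia.
move=> e; have ea : digit a = digit b :> nat.
  have : ((numeral p * base + digit a) %% base = (numeral q * base + digit b) %% base)%N by rewrite e.
  by rewrite !modnMDl !modn_small.
rewrite ea in e; move/addIn: e => /eqP; rewrite eqn_mul2r => /eqP/IH ->.
by move/val_inj/lift_inj/enum_rank_inj: ea => ->.
Qed.

Definition blocks : seq zone := [seq Block k | k <- enum 'I_(size wt)].

Definition leads (p : seq S) : seq zone := if p is x :: p' then Lead x :: map Body p' else [::].

Definition zones a p K c : seq zone :=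
  nseq a LeftPad ++ leads p ++ flatten (nseq K blocks) ++ nseq c RightPad.

(** What may follow [z] in a first row, stated for every kind of zone so that induction can proceed
    from the right end. *)
Definition suffix_shape (z : zone) (s : seq zone) : Prop :=
  match z with
  | RightPad => exists c, s = nseq c RightPad
  | Block k => exists K c, z :: s = drop k blocks ++ flatten (nseq K blocks) ++ nseq c.+1 RightPad
  | Lead _ | Body _ =>
      exists p K c, s = map Body p ++ flatten (nseq K blocks) ++ nseq c.+1 RightPad
  | LeftPad => exists a x p K c,
      s = nseq a LeftPad ++ leads (x :: p) ++ flatten (nseq K blocks) ++ nseq c.+1 RightPad
  end.

Lemma size_blocks : size blocks = size wt.
Proof. by rewrite size_map size_enum_ord. Qed.

Lemma drop_blocks (k : 'I_(size wt)) : drop k blocks = Block k :: drop k.+1 blocks.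
Proof.
rewrite (drop_nth (Block k)) ?size_blocks //; congr (_ :: _).
by rewrite (nth_map k) ?size_enum_ord // nth_ord_enum.
Qed.

Lemma suffix_shapeP z s : path (@adjacent_zones S wt) z s -> last z s = RightPad -> suffix_shape z s.
Proof.
elim: s z => [|z' s IH] z; first by move=> _ /= ->; exists 0%N.
move=> /= /andP[azz /IH{}IH] /IH{}IH.
have body : z' = RightPad \/ (exists b, z' = Body b) \/ (exists k, z' = Block k /\ k = 0%N :> nat) ->
    exists p K c, z' :: s = map Body p ++ flatten (nseq K blocks) ++ nseq c.+1 RightPad.
  case=> [e|[[b e]|[k [e k0]]]]; rewrite e /= in IH *.
  - by case: IH => c ->; exists [::], 0%N, c.
  - by case: IH => p [K [c ->]]; exists (b :: p), K, c.
  - by case: IH => K [c ->]; exists [::], K.+1, c; rewrite k0 drop0 /= catA.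
case: z azz => [||x|x|k] /=.
- case: z' IH body => [||y|y|k] //= IH _ _.
    by case: IH => a [x [p [K [c ->]]]]; exists a.+1, x, p, K, c.
  by case: IH => p [K [c ->]]; exists 0%N, y, p, K, c.
- by case: z' IH body => [||y|y|k] //= [c ->] _ _; exists c.+1.
- case: z' IH body => [||y|y|k] //= IH body.
  + by move=> _; apply: body; left.
  + by move=> _; apply: body; right; left; exists y.
  + by move=> /eqP k0; apply: body; right; right; exists k.
- case: z' IH body => [||y|y|k] //= IH body.
  + by move=> _; apply: body; left.
  + by move=> _; apply: body; right; left; exists y.
  + by move=> /eqP k0; apply: body; right; right; exists k.
- have full : k.+1 = size wt -> drop k.+1 blocks = [::] by move=> e; rewrite drop_oversize // size_blocks e.
  case: z' IH body => [||y|y|k'] //= IH _.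
    move=> /eqP e; case: IH => c ->; exists 0%N, c.
    by rewrite drop_blocks full.
  case: IH => K [c IH]; case/orP => [/eqP e|/andP[/eqP e /eqP k0]].
    by exists K, c; rewrite drop_blocks IH -e.
  by exists K.+1, c; rewrite drop_blocks full // IH k0 drop0 /= -catA.
Qed.

Section Values.
Variable W : nat.
Implicit Types (g : nat -> option 'I_base) (t : nat -> bool).

(* Horner value of the digits minus that of the tokens, a column without a digit having
   the weight of the next digit to its left; it is invariant under the local rule as long
   as no token leaves on the left. *)
Fixpoint balance g t n : int :=
  if n is m.+1 then
    (if g m is Some i then balance g t m * base%:Z + i%:Z else balance g t m) - (t m : nat)%:Z
  else 0.

(** The correction is the token entering the prefix from column [n]; none enters when [n = W], so
    the full balance is conserved. *)
Lemma balance_next g t n : ~~ emits (g 0%N) (t 0%N) -> (n <= W)%N ->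
  balance (next_digits g t) (next_tokens W g t) n =
  balance g t n - ((n < W)%N && emits (g n) (t n) : nat)%:Z.
Proof.
move=> e0; elim: n => [|n IH] nW /=; first by rewrite (negPf e0) andbF.
rewrite {}IH ?(ltnW nW) // nW /next_digits /next_tokens /new_digit /emits /=.
case: (g n) => [i|] /=; case: (t n) => //=; rewrite ?subr0 //.
(* A token on the digit 0 borrows: (v - 1) * base + (base - 1) = v * base - 1. *)
set x := (X in _ - X); case: (eqVneq i ord0) => [->|i0] /=.
  by rewrite mulrBl mul1r; move: (balance g t n * _) => v; lia.
rewrite inordK; last exact: leq_ltn_trans (leq_pred _) (ltn_ord i).
have {}i0 : (0 < i)%N by rewrite lt0n.
rewrite subr0; congr (_ - x); rewrite -addrA; congr (_ + _); exact: predn_int.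
Qed.

Definition zone_balance (v : int) (z : zone) : int :=
  (if digit_part (start_of z) is Some i then v * base%:Z + i%:Z else v) - (token_part (start_of z) : nat)%:Z.

Lemma balance_zones (z : seq zone) n : (n <= size z)%N ->
  balance (fun j => digit_part (start_of (nth LeftPad z j)))
          (fun j => token_part (start_of (nth LeftPad z j))) n =
  foldl zone_balance 0 (take n z).
Proof.
elim: n => [|n IH] nz; first by rewrite take0.
by rewrite (take_nth LeftPad) // foldl_rcons -IH // ltnW.
Qed.

End Values.

Lemma input_nth (w : seq S) a c j :
  input_tape M w (j%:Z - a%:Z) = nth None (nseq a None ++ map (Some \o inl) w ++ nseq c None) j.
Proof.
rewrite nth_cat size_nseq; case: ltnP => ja.
  rewrite nth_nseq if_same; have -> : j%:Z - a%:Z = Negz (a - j).-1 by lia.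
  by [].
have -> : j%:Z - a%:Z = (j - a)%N by lia.
rewrite /= nth_cat size_map; case: ltnP => jw.
  by rewrite onthE (nth_map a0) //= (nth_map a0).
by rewrite nth_nseq if_same onth_default.
Qed.

(** [Lead] stands in column [a], which is therefore the origin of the machine's tape. *)
Lemma zones_row a x p K c j : (j < size (zones a (x :: p) K c))%N ->
  machine_row a (initial M ((x :: p) ++ flatten (nseq K wt)))
    (fun j => digit_part (start_of (nth LeftPad (zones a (x :: p) K c) j)))
    (fun j => token_part (start_of (nth LeftPad (zones a (x :: p) K c) j))) j =
  start_of (nth LeftPad (zones a (x :: p) K c) j).
Proof.
set z := zones _ _ _ _ => jz.
rewrite /machine_row [RHS](_ : _ = Dyn (tape_part (start_of (nth LeftPad z j))) (head_part (start_of (nth LeftPad z j)))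
   (digit_part (start_of (nth LeftPad z j))) (token_part (start_of (nth LeftPad z j)))); last first.
  by case: (start_of _) => [[[]]].
congr Dyn.
- transitivity (input_tape M ((x :: p) ++ flatten (nseq K wt)) (j%:Z - a%:Z)); first by [].
  rewrite (input_nth _ _ c) -(nth_map _ None (fun y => tape_part (start_of y))) //; congr nth.
  rewrite /z /zones !map_cat !map_nseq /= -!map_comp; congr (_ ++ _ :: _).
  rewrite -[LHS]catA; congr (_ ++ (_ ++ _)).
  rewrite !map_flatten !map_nseq; congr (flatten (nseq _ _)).
  rewrite /blocks -map_comp -[in LHS](mkseq_nth a0 wt) /mkseq -val_enum_ord -!map_comp.
  exact: eq_map.
- rewrite /= -(nth_map _ None (fun y => head_part (start_of y))) //.
  have -> : [seq head_part (start_of y) | y <- z] =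
     nseq a None ++ Some (start M) :: nseq (size p + (K * size wt + c)) None.
    rewrite /z /zones !map_cat !map_nseq /= -!map_comp; congr (_ ++ _ :: _).
    rewrite !nseqD; congr (_ ++ _); first by elim: (p) => //= ? ? ->.
    congr (_ ++ _); elim: (K) => //= k IH; rewrite map_cat IH mulSn nseqD; congr (_ ++ _).
    rewrite /blocks -map_comp; transitivity (nseq (size (enum 'I_(size wt))) (None : option (state M))).
      by elim: (enum 'I_(size wt)) => //= ? ? ->.
    by rewrite size_enum_ord.
  rewrite nth_cat size_nseq; case: ltnP => ja.
    by rewrite nth_nseq if_same; case: eqP => //; lia.
  case: eqP => e; first by have -> : (j - a = 0)%N by lia.
  have -> : (j - a = (j - a).-1.+1)%N by lia.
  by rewrite /= nth_nseq if_same.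
Qed.

Hypothesis wt_gt0 : (0 < size wt)%N.

Lemma count_block_start : count (fun k : 'I_(size wt) => k == 0%N :> nat) (enum 'I_(size wt)) = 1%N.
Proof.
rewrite (eq_count (a2 := pred1 (Ordinal wt_gt0))); last by move=> k; apply/eqP/eqP => [e|->//]; apply: val_inj.
by rewrite count_uniq_mem ?enum_uniq // mem_enum.
Qed.

(** Leading zeros contribute nothing, the prefix its numeral, and each block the -1 of its token. *)
Lemma zone_balance_zones a p K c :
  foldl zone_balance 0 (zones a p K c) = (numeral p)%:Z - K%:Z.
Proof.
rewrite /zones !foldl_cat.
have -> : foldl zone_balance 0 (nseq a LeftPad) = 0 by elim: a => // a IH; rewrite /= {2}/zone_balance /= !subr0.
have -> : foldl zone_balance 0 (leads p) = (numeral p)%:Z.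
  have E v s : foldl zone_balance v%:Z (map Body s) = (foldl (fun v a => v * base + digit a)%N v s)%:Z.
    elim: s v => //= a' s IH v; rewrite -IH; congr foldl; rewrite /zone_balance /=; lia.
  case: p => [|x p] //=; rewrite /numeral /= -E; congr foldl; rewrite /zone_balance /=; lia.
have block v : foldl zone_balance v blocks = v - 1.
  have E (s : seq 'I_(size wt)) u : foldl zone_balance u (map Block s) =
      u - (count (fun k : 'I_(size wt) => k == 0%N :> nat) s)%:Z.
    elim: s u => [|k s IH] u /=; first by rewrite subr0.
    by rewrite IH /zone_balance /=; lia.
  by rewrite E count_block_start.
have -> v : foldl zone_balance v (flatten (nseq K blocks)) = v - K%:Z.
  elim: K v => [|K IH] v /=; first by rewrite subr0.
  by rewrite foldl_cat block IH; lia.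
by elim: c => // c IH; rewrite /= {2}/zone_balance /= subr0.
Qed.

Definition zone_block (z : zone) : bool := if z is Block k then k == 0%N :> nat else false.

Lemma count_zones a p K c : count zone_block (zones a p K c) = K.
Proof.
rewrite /zones !count_cat !count_nseq /= !mul0n addn0 add0n.
have -> : count zone_block (leads p) = 0%N.
  by case: p => //= x p; elim: p.
rewrite add0n; elim: K => //= K IH; rewrite count_cat IH -add1n; congr (_ + _)%N.
by rewrite count_map -count_block_start; exact: eq_count.
Qed.

End Sound.

(** * Runs frozen at the verdict, and soundness of tableaux *)

Section Runs.

Variables (S : finType) (M : TM S).

Lemma settle_running w r : verdict (cstate (iter r (@settle S M) (initial M w))) = None ->
  iter r (@settle S M) (initial M w) = iter r (@step S M) (initial M w) /\
  forall k, (k <= r)%N -> verdict (cstate (iter k (@step S M) (initial M w))) = None.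
Proof.
elim: r => [|r IH] /=; first by move=> v; split => // k; rewrite leqn0 => /eqP ->.
set X := iter r (@settle S M) _ in IH *; rewrite /settle.
case V : (verdict (cstate X)) => [b|]; first by rewrite V.
move=> V'; have [e hk] := IH V; rewrite e in V' *; split => // k.
by rewrite leq_eqVlt => /orP[/eqP ->//|]; exact: hk.
Qed.

Lemma settle_answers w r b :
  verdict (cstate (iter r (@settle S M) (initial M w))) = Some b -> answers M w b.
Proof.
elim: r => [|r IH] /=; first by move=> v; exists 0%N; split.
set X := iter r (@settle S M) _ in IH *; rewrite /settle.
case V : (verdict (cstate X)) => [b'|]; first by rewrite V => -[e]; apply: IH; rewrite V e.
have [e hk] := settle_running V; rewrite -/X in e; rewrite e => V'; by exists r.+1; split.
Qed.

Lemma answers_unique w b b' : answers M w b -> answers M w b' -> b = b'.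
Proof.
move=> [m [hm lt]] [m' [hm' lt']]; case: (ltngtP m m') => h.
- by have := lt' _ h; rewrite hm.
- by have := lt _ h; rewrite hm'.
- by move: hm'; rewrite -h hm => -[].
Qed.

Lemma head_bound w r : (`|chead (iter r (@step S M) (initial M w))| <= r)%N.
Proof.
elim: r => //= r; rewrite {2}/step; case: trans => -[q a] d /=.
by case: d => /=; lia.
Qed.

(** The halting time serves as [m]: it also bounds the excursion of the head, which moves at most
    one cell per step. *)
Lemma answers_settle w b : answers M w b -> exists m, forall r,
  (`|chead (iter r (@settle S M) (initial M w))| <= m)%N /\
  ((m <= r)%N -> verdict (cstate (iter r (@settle S M) (initial M w))) = Some b).
Proof.
move=> [m [hm lt]]; exists m.
have early r : (r <= m)%N ->
    iter r (@settle S M) (initial M w) = iter r (@step S M) (initial M w).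
  by elim: r => //= r IH rm; rewrite IH ?(ltnW rm) // /settle lt.
have late k : iter (k + m) (@settle S M) (initial M w) = iter m (@step S M) (initial M w).
  by elim: k => [|k IH]; [by rewrite early|rewrite addSn /= IH /settle hm].
move=> r; case: (leqP r m) => rm.
  rewrite early //; split; first exact: leq_trans (head_bound w r) rm.
  by move=> mr; have -> : r = m by lia.
by rewrite -(subnK (ltnW rm)) late; split; [exact: head_bound|by move=> _].
Qed.

Variables (wt : seq S) (a0 : S).
Hypothesis wt_gt0 : (0 < size wt)%N.
Local Notation base := #|S|.+1.
Local Notation zone := (zone S (size wt)).
Local Notation start_of := (@start_of S M wt a0).

Definition counter W g t r :=
  iter r (fun gt : (nat -> option 'I_base) * (nat -> bool) =>
            (next_digits gt.1 gt.2, next_tokens W gt.1 gt.2)) (g, t).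

Local Notation tableau N := (tableau N (@vertical S M wt a0) (@accepting S M wt)
  (@adjacent S M wt) (@block_start S M wt)).

(** The first row is a path for [adjacent_zones] from border to border, which fixes its shape;
    [tableau_count] then identifies the number of blocks with [N]. *)
Lemma tableau_zones N H W T : tableau N H W T ->
  exists a x p c, [/\ W = size (zones wt a (x :: p) N c) &
    forall j, (j < W)%N -> T 0%N j.+1 = Some (inl (nth LeftPad (zones wt a (x :: p) N c) j))].
Proof.
move=> tab; have H1 := tableau_height tab.
have [b0 b1] := tableau_border tab (ltnW H1).
have adj := tableau_first tab.
have zE j : (j < W)%N -> exists y : zone, T 0%N j.+1 = Some (inl y).
  move=> jW; have [c [d [Tc _ _]]] := tableau_vert tab H1 jW.
  have := adj j (ltnW jW); rewrite Tc; case: c {Tc} => [y _|d']; first by exists y.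
  by case: (T 0%N j) => [[[||?|?|?]|?]|].
pose z := [seq (if T 0%N j.+1 is Some (inl y) then y else LeftPad) | j <- iota 0 W] : seq zone.
have zn j : (j < W)%N -> T 0%N j.+1 = Some (inl (nth LeftPad z j)).
  move=> jW; rewrite (nth_map 0%N) ?size_iota // nth_iota // add0n.
  by have [y ->] := zE j jW.
have sz : size z = W by rewrite size_map size_iota.
have W0 : (0 < W)%N.
  by case: (posnP W) adj b1 => // -> /(_ 0%N isT); rewrite b0 => + b1; rewrite b1.
have hd : nth LeftPad z 0 = LeftPad.
  by have := adj 0%N (leq0n _); rewrite b0 zn //; case: (nth _ _ _).
have zz : z = LeftPad :: behead z.
  by move: sz hd W0; case: (z) => [<- //|y s /= _ ->].
have lst : nth LeftPad z W.-1 = RightPad.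
  have := adj W (leqnn _); rewrite b1; case: (W) W0 zn => // m _ zn.
  by rewrite zn //=; case: (nth _ _ _).
have pth : path (@adjacent_zones S wt) LeftPad (behead z).
  apply/(pathP LeftPad) => i; rewrite size_behead sz => iW.
  have hi : (i.+1 < W)%N by lia.
  have := adj i.+1 (ltnW hi); rewrite !zn ?(ltnW hi) // -zz nth_behead.
  by case: (nth LeftPad z i).
have lst' : last LeftPad (behead z) = RightPad.
  by rewrite -lst -sz {2 3}zz /= (last_nth LeftPad).
have := suffix_shapeP pth lst'; move=> [a [x [p [K [c ze]]]]].
have z_zones : z = zones wt a.+1 (x :: p) K c.+1.
  by rewrite zz ze.
have KN : K = N.
  rewrite -(count_zones wt_gt0 a.+1 (x :: p) K c.+1) -z_zones -(tableau_count tab).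
  rewrite -sum1_count big_mkcond (big_nth LeftPad) sz big_mkord.
  by apply: eq_bigr => j _; rewrite zn //=; case: (nth _ _ _).
exists a.+1, x, p, c.+1; rewrite -KN -z_zones; split => //.
Qed.

(** By induction on [r], row [r] shows [r] settled steps of the machine, with its head inside the
    columns and the balance unchanged. The last row then yields both the verdict and balance 0. *)
Theorem tableau_sound N H W T : tableau N H W T ->
  exists p, numeral p = N /\ answers M (p ++ flatten (nseq N wt)) true.
Proof.
move=> tab; have H1 := tableau_height tab.
have [a [x [p [c [Wz zn]]]]] := tableau_zones tab.
set z := zones _ _ _ _ _ in Wz zn.
exists (x :: p); set w := _ ++ _.
pose g := (fun j => digit_part (start_of (nth LeftPad z j))).
pose t := (fun j => token_part (start_of (nth LeftPad z j))).
pose cfg r := iter r (@settle S M) (initial M w).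
pose cnt r := counter W g t r.
pose R r := machine_row a (cfg r) (cnt r).1 (cnt r).2.
have inv r : (r < H)%N -> [/\ exists2 h, (h < W)%N & chead (cfg r) = h%:Z - a%:Z,
    balance (cnt r).1 (cnt r).2 W = (numeral (x :: p))%:Z - N%:Z &
    forall j, (j < W)%N -> omap (@value S M wt a0) (T r j.+1) = Some (R r j)].
  elim: r => [|r IH] rH.
    split.
    - exists a; last by rewrite /= subrr.
      by rewrite Wz /z /zones size_cat size_nseq /= addnS ltnS leq_addr.
    - by rewrite /cnt /= {1}Wz balance_zones // take_size zone_balance_zones.
    - move=> j jW; rewrite zn //= /R /cnt /=; congr Some.
      by rewrite zones_row // -Wz.
  have [[h hW hc] bal rows] := IH (ltnW rH).
  have lft j : (j < W)%N -> omap (@value S M wt a0) (T r j) = left_of (R r) j.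
    case: j => [|j] jW; first by have [-> _] := tableau_border tab (ltnW rH).
    by rewrite /= rows // ltnW.
  have rgt j : (j < W)%N -> omap (@value S M wt a0) (T r j.+2) = right_of W (R r) j.
    move=> jW; rewrite /right_of; case: ltnP => jW'; first exact: rows.
    have -> : j.+1 = W by lia.
    by have [_ ->] := tableau_border tab (ltnW rH).
  have vert j : (j < W)%N -> [/\ ((j == 0%N) && exits_left (R r j)) = false,
      ((j.+1 == W) && exits_right (R r j)) = false &
      omap (@value S M wt a0) (T r.+1 j.+1) = Some (R r.+1 j)].
    move=> jW; have [d [d' [Td Td' v]]] := tableau_vert tab rH jW.
    move: v; rewrite /vertical Td'; case: d' {Td'} => // d' /eqP.
    rewrite lft // rgt //; have := rows j jW; rewrite Td /= => -[->].
    rewrite (local_ruleE _ _ jW hW hc); case: ifP => // /norP[/negPf -> /negPf ->] [<-].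
    by split.
  split.
  - have hr : settle (cfg r) = cfg r.+1 by [].
    have [v1 v2 _] := vert h hW.
    rewrite -hr /settle; case V : verdict => [b|]; first by exists h.
    move: v1 v2; rewrite /exits_left /exits_right /action /head_part /R /machine_row /=.
    rewrite hc eqxx V /tape_part /= /step hc.
    case: trans => -[q' s'] d /=; case: d => /=.
    + rewrite orbT andbT => /eqP h0 _; exists h.-1; lia.
    + by move=> _ _; exists h => //; rewrite addr0.
    + rewrite andbT => _ /eqP hw; exists h.+1; lia.
  - rewrite -bal /cnt /counter iterS -/(counter W g t r) -/(cnt r) /= balance_next ?leqnn // ?ltnn ?subr0 //.
    have [v1 _ _] := vert 0%N (leq_ltn_trans (leq0n _) hW).
    by move: v1; rewrite /= /exits_left => /negbT/norP[].
  - by move=> j jW; have [_ _] := vert j jW.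
have lastR j : (j < W)%N -> T H.-1 j.+1 = Some (inr (R H.-1 j)) /\ accepting (wt := wt) (inr (R H.-1 j)).
  move=> jW; have [c' Tc ac] := tableau_last tab jW.
  have [_ _ /(_ j jW)] := inv H.-1 ltac:(lia).
  rewrite Tc => -[]; case: c' Tc ac => // d Td ad dR.
  by have <- : d = R H.-1 j := dR.
have [[h hW hc] bal _] := inv H.-1 ltac:(lia).
split.
  (* Accepting cells carry no token and no nonzero digit. *)
  have zero n : (n <= W)%N -> balance (cnt H.-1).1 (cnt H.-1).2 n = 0.
    elim: n => //= n IH nW; have [_] := lastR n nW.
    rewrite /accepting /R /machine_row /= IH ?(ltnW nW) // /digit_part /token_part /=.
    case: ((cnt H.-1).1 n) => [i|]; case: ((cnt H.-1).2 n); rewrite ?andbF ?andbT //.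
    by case/andP => _ /eqP ->; rewrite mul0r.
  by move: bal; rewrite zero //; lia.
have [_] := lastR h hW.
rewrite /accepting /R /machine_row /head_part /= hc eqxx => /and3P[/eqP V _ _].
exact: settle_answers V.
Qed.

End Runs.

(** * From an accepting run to a tableau *)

Section Complete.

Variables (S : finType) (M : TM S) (wt : seq S) (a0 : S).
Hypothesis wt_gt0 : (0 < size wt)%N.
Local Notation base := #|S|.+1.
Local Notation zone := (zone S (size wt)).
Local Notation start_of := (@start_of S M wt a0).
Local Notation tableau N := (tableau N (@vertical S M wt a0) (@accepting S M wt)
  (@adjacent S M wt) (@block_start S M wt)).

Lemma path_pad c : path (@adjacent_zones S wt) RightPad (nseq c RightPad).
Proof. by elim: c. Qed.

Lemma path_blocks (y : zone) K c :
  adjacent_zones y RightPad -> (forall k : 'I_(size wt), k = 0%N :> nat -> adjacent_zones y (Block k)) ->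
  path (@adjacent_zones S wt) y (flatten (nseq K (blocks wt)) ++ nseq c.+1 RightPad).
Proof.
elim: K y => [|K IH] y yR yB; first by rewrite /= yR path_pad.
rewrite /= -catA cat_path; apply/andP; split.
  apply/(pathP y) => i; rewrite size_blocks => iw.
  have nB j (jw : (j < size wt)%N) : nth y (blocks wt) j = Block (Ordinal jw).
    rewrite (nth_map (Ordinal jw)) ?size_enum_ord //; congr Block.
    by apply: val_inj; rewrite /= nth_enum_ord.
  case: i iw => [|i] iw; first by rewrite nB; apply: yB.
  by rewrite /= !nB ?(ltnW iw) //= eqxx.
have lst : exists2 k : 'I_(size wt), last y (blocks wt) = Block k & k.+1 = size wt.
  have lw : ((size wt).-1 < size wt)%N by rewrite prednK.
  exists (Ordinal lw); last by rewrite /= prednK.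
  rewrite -nth_last size_blocks (nth_map (Ordinal lw)) ?size_enum_ord //; congr Block.
  by apply: val_inj; rewrite /= nth_enum_ord.
case: lst => k -> kw; apply: IH => /=; first by apply/eqP.
by move=> k' k0; rewrite kw eqxx k0 eqxx orbT.
Qed.

Lemma path_zones a x p K c :
  path (@adjacent_zones S wt) LeftPad (zones wt a (x :: p) K c.+1).
Proof.
elim: a => // ; rewrite /zones /=.
have E (y : zone) : adjacent_zones y RightPad ->
   (forall k : 'I_(size wt), k = 0%N :> nat -> adjacent_zones y (Block k)) ->
   (forall b, adjacent_zones y (Body b)) ->
   path (@adjacent_zones S wt) y
     ([seq Body i | i <- p] ++ flatten (nseq K (blocks wt)) ++ RightPad :: nseq c RightPad).
  elim: p y => [|b p IH] y h1 h2 h3; first exact: path_blocks.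
  by rewrite /= h3 IH //= => k ->.
by apply: E => //= k ->.
Qed.

(** A token leaving column 0 makes the first prefix worth -1, and [v * base + i] is at most -1 when
    [v] is and [i < base]. So balance 0 rules out losing a token. *)
Lemma balance_negative (g : nat -> option 'I_base) t n :
  isSome (g 0%N) -> emits (g 0%N) (t 0%N) -> (0 < n)%N -> balance g t n <= -1.
Proof.
move=> s0 e0; case: n => // n _; elim: n => [|n IH].
  rewrite /=; move: s0 e0; rewrite /emits; case: (g 0%N) => // i _.
  by case/andP => -> /eqP ->; rewrite mul0r.
have -> : balance g t n.+2 = (if g n.+1 is Some i then balance g t n.+1 * base%:Z + i%:Z
    else balance g t n.+1) - (t n.+1 : nat)%:Z by [].
move: IH; move: (balance g t n.+1) => v hv.
have : 0 <= (t n.+1 : nat)%:Z by [].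
move: ((t n.+1 : nat)%:Z) => e e_ge0; case: (g n.+1) => [i|]; rewrite lerBlDr (@le_trans _ _ (-1)) ?lerDl //.
have h1 : v * base%:Z <= (-1) * base%:Z by rewrite ler_pM2r.
have h2 : i%:Z <= base%:Z - 1 by rewrite lerBrDr -PoszD addn1 lez_nat ltn_ord.
by apply: le_trans (lerD h1 h2) _; rewrite mulN1r addrA addNr add0r.
Qed.

Lemma balance_ge0 (g : nat -> option 'I_base) n : 0 <= balance g xpred0 n.
Proof.
elim: n => //= n IH; case: (g n) => [i|]; rewrite subr0 //.
by rewrite addr_ge0 // mulr_ge0.
Qed.

Lemma balance_zero (g : nat -> option 'I_base) n j : balance g xpred0 n = 0 -> (j < n)%N ->
  if g j is Some i then i = ord0 else True.
Proof.
elim: n => // n IH /=; rewrite subr0 ltnS leq_eqVlt => e.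
have [e1 e2] : balance g xpred0 n = 0 /\ (if g n is Some i then i = ord0 else True).
  move: e; case: (g n) => [i|] // /eqP.
  rewrite paddr_eq0 ?mulr_ge0 ?balance_ge0 // mulf_eq0 orbF => /andP[/eqP -> /eqP e].
  by split => //; apply: val_inj; case: e.
by case/orP => [/eqP ->|]; [|exact: IH].
Qed.

(** The rows are written down from the run; the padding keeps the head off the border, and balance 0
    keeps the tokens inside. *)
Theorem tableau_complete p : p <> [::] ->
  answers M (p ++ flatten (nseq (numeral p) wt)) true ->
  exists H W T, tableau (numeral p) H W T.
Proof.
case: p => // x p _; set N := numeral _; set w := _ ++ _ => ans.
have [m hm] := answers_settle ans.
(* The head strays at most [m] cells from its origin, so [m.+1] padding columns on each side
   suffice. *)
pose a := m.+1; pose z := zones wt a (x :: p) N m.+1.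
pose W := size z.
pose g := (fun j => digit_part (start_of (nth LeftPad z j))).
pose t := (fun j => token_part (start_of (nth LeftPad z j))).
pose cfg r := iter r (@settle S M) (initial M w).
pose cnt r := counter W g t r.
pose R r := machine_row a (cfg r) (cnt r).1 (cnt r).2.
have cntS r : cnt r.+1 = (next_digits (cnt r).1 (cnt r).2, next_tokens W (cnt r).1 (cnt r).2) by [].
have Wge : (2 * m + 3 <= W)%N.
  by rewrite /W /z /zones !size_cat !size_nseq /= /a; lia.
have kind r j : isSome ((cnt r).1 j) = isSome (g j).
  elim: r => // r IH; rewrite cntS /= /next_digits /new_digit -IH.
  by case: ifP => // _; case: ((cnt r).1 j).
have noemit r : balance (cnt r).1 (cnt r).2 W = 0 -> ~~ emits ((cnt r).1 0%N) ((cnt r).2 0%N).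
  move=> b0; apply/negP => e0.
  have W0 : (0 < W)%N by lia.
  have := @balance_negative (cnt r).1 (cnt r).2 W; rewrite kind b0 => /(_ isT e0 W0).
  by rewrite oppr_ge0 ler10.
have bal r : balance (cnt r).1 (cnt r).2 W = 0.
  elim: r => [|r IH].
    transitivity (foldl (@zone_balance S M wt a0) 0 (take W z)); first exact: balance_zones.
    by rewrite take_size zone_balance_zones // subrr.
  have := balance_next (noemit r IH) (leqnn W); rewrite IH ltnn subr0; exact.
(* Tokens move left one column per row, so none is left after [W] rows. *)
have tok r j : (cnt r).2 j -> (j + r < W)%N.
  elim: r j => [|r IH] j.
    rewrite addn0 ltnNge; apply: contraTN => Wj.
    by rewrite /cnt /= /t nth_default.
  by rewrite cntS /= /next_tokens /emits => /and3P[_ /IH + _]; lia.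
have head r : exists2 h, (0 < h < W.-1)%N & chead (cfg r) = h%:Z - a%:Z.
  have [h1 _] := hm r; exists `|(chead (cfg r) + a%:Z)%R|%N; rewrite /cfg /a; move: h1;
  move: (chead _) => u; lia.
have rule r j : (j < W)%N ->
    local_rule (left_of (R r) j) (R r j) (right_of W (R r) j) = Some (R r.+1 j).
  move=> jW; have [h hW hc] := head r.
  rewrite (@local_ruleE _ _ W a _ _ _ _ h) //; last by lia.
  case: ifP => // /orP[/andP[/eqP j0]|/andP[/eqP jl]].
    rewrite j0 /exits_left /emits_part /digit_part /token_part /= (negPf (noemit r (bal r))) /=.
    rewrite /action /head_part /= hc.
    by have -> : (h%:Z - a%:Z == 0%N%:Z - a%:Z) = false by lia.
  rewrite /exits_right /action /head_part /= hc.
  by have -> : (h%:Z - a%:Z == j%:Z - a%:Z) = false by lia.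
pose T r j : option (cell M wt) := if j is i.+1 then
   if (i < W)%N then Some (if r is 0%N then inl (nth LeftPad z i) else inr (R r i)) else None
   else None.
have val r j : (j < W)%N -> omap (@value S M wt a0) (T r j.+1) = Some (R r j).
  rewrite /T => jW; rewrite jW; case: r => [|r] //=.
  by rewrite /R /cnt /=; congr Some; rewrite zones_row.
(* Enough rows for the machine to halt and for all tokens to be absorbed. *)
pose H := (m + W).+2.
have nz0 : nth LeftPad z 0 = LeftPad by [].
have pth := path_zones a x p N m; rewrite -/z in pth.
exists H, W, T; split.
- by [].
- by move=> r _; rewrite /T ltnn.
- move=> j jW; rewrite /T; case: j jW => [|j] jW.
    by have -> : (0 < W)%N by lia.
  rewrite jW; move: jW; rewrite leq_eqVlt => /orP[/eqP e|jW].
    have -> : (j.+1 < W)%N = false by lia.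
    have -> : nth LeftPad z j = RightPad; last by [].
    have -> : j = W.-1 by lia.
    rewrite /W nth_last /z /zones !last_cat /=.
    by elim: (m).
  rewrite jW; have /(pathP LeftPad)/(_ j.+1 jW) /= := pth.
  by case: (nth LeftPad z j).
- move=> r j rH jW.
  exists (if r is 0%N then inl (nth LeftPad z j) else inr (R r j)), (inr (R r.+1 j)).
  rewrite {1 2}/T jW; split => //.
  have vj := val r j jW; rewrite /T jW in vj; case: vj => vj.
  have lft : omap (@value S M wt a0) (T r j) = left_of (R r) j.
    by case: j jW {vj} => [|j] jW //; rewrite val // ltnW.
  have rgt : omap (@value S M wt a0) (T r j.+2) = right_of W (R r) j.
    rewrite /right_of; case: ltnP => jW'; first exact: val.
    by rewrite /T ltnNge jW'.
  by rewrite /vertical lft rgt vj rule.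
- move=> j jW; exists (inr (R H.-1 j)); first by rewrite /T jW.
  have notok : (cnt H.-1).2 = xpred0.
    by apply/funext => i; apply/negP => /tok; rewrite /H; lia.
  have bz := bal H.-1; rewrite notok in bz.
  have accE : accepting (wt := wt) (inr (R H.-1 j)) =
      [&& (if chead (cfg H.-1) == j%:Z - a%:Z then verdict (cstate (cfg H.-1)) == Some true else true),
          (if (cnt H.-1).1 j is Some i then i == ord0 else true) & ~~ (cnt H.-1).2 j].
    by rewrite /accepting /R /machine_row /head_part /tape_part; case: (chead _ == _).
  rewrite accE notok andbT; apply/andP; split.
    by have [_ ->] := hm H.-1; [case: ifP|rewrite /H; lia].
  by have := balance_zero bz jW; case: ((cnt H.-1).1 j) => // i ->.
- rewrite -[RHS](count_zones wt_gt0 a (x :: p) N m.+1) -/z.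
  rewrite -sum1_count [RHS]big_mkcond [RHS](big_nth LeftPad) -/W [RHS]big_mkord.
  apply: eq_bigr => j _; rewrite /T ltn_ord /=.
  by case: (nth _ _ _).
Qed.

End Complete.

(** * The matrix of the automaton *)

Section Encoding.

(** The encoding ends with the word of the last term of the last entry, without an end mark, so
    lengthening that word appends to the whole encoding. *)
Lemma encode_mx_last n k (M M' : 'M[formal n]_k.+1) z w w' :
  M ord_max ord_max = [:: (z, w)] -> M' ord_max ord_max = [:: (z, w ++ w')] ->
  (forall i j, (i, j) != (ord_max, ord_max) -> M' i j = M i j) ->
  encode_mx (existT _ k M') = encode_mx (existT _ k M : presented_mx n) ++ [seq inl l | l <- w'].
Proof.
move=> hM hM' e.
have lastE (A : 'M[formal n]_k.+1) : encode_mx (existT _ k A : presented_mx n) =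
    (encode_rows [seq [seq A i j | j <- enum 'I_k.+1] | i <- [seq widen_ord (leqnSn k) i | i <- enum 'I_k]]
     ++ inr Row :: (encode_row [seq A ord_max j | j <- [seq widen_ord (leqnSn k) j | j <- enum 'I_k]]
       ++ inr Entry :: encode_formal (A ord_max ord_max))).
  rewrite /encode_mx /mx_rows /= [X in map _ X]enum_ordSr map_rcons /encode_rows map_rcons flatten_rcons.
  congr (_ ++ _ :: _); rewrite /encode_row enum_ordSr map_rcons map_rcons flatten_rcons.
  by [].
rewrite !lastE hM hM'.
have ne (i : 'I_k) : (widen_ord (leqnSn k) i == ord_max) = false by rewrite -val_eqE /= ltn_eqF.
have -> : [seq [seq M' i j | j <- enum 'I_k.+1] | i <- [seq widen_ord (leqnSn k) i | i <- enum 'I_k]] =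
          [seq [seq M i j | j <- enum 'I_k.+1] | i <- [seq widen_ord (leqnSn k) i | i <- enum 'I_k]].
  rewrite -!map_comp; apply: eq_map => i /=; apply: eq_map => j; apply: e.
  by rewrite xpair_eqE ne.
have -> : [seq M' ord_max j | j <- [seq widen_ord (leqnSn k) j | j <- enum 'I_k]] =
          [seq M ord_max j | j <- [seq widen_ord (leqnSn k) j | j <- enum 'I_k]].
  rewrite -!map_comp; apply: eq_map => j /=; apply: e.
  by rewrite xpair_eqE ne andbF.
rewrite /encode_formal /= !cats0 /encode_term /= map_cat.
by rewrite -?catA ?cat_cons -?catA ?cat_cons -?catA ?cat_cons -?catA.
Qed.

End Encoding.

(** * The group ring action on words, and square-summability *)

Section GroupRingAction.

Variables (R : realType) (G : groupType).

Lemma gractD (a b : {malg int[G]}) (xi : G -> R[i]) h :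
  gract (a + b) xi h = gract a xi h + gract b xi h.
Proof.
by rewrite /gract -!(monalg.mmapE (intmul 1) (fun g => xi (g^-1 * h)%g)) monalg.mmapD.
Qed.

Lemma gract0 (xi : G -> R[i]) h : gract 0 xi h = 0.
Proof. by rewrite /gract monalg.msupp0 big_seq_fset0. Qed.

Lemma gractU z g (xi : G -> R[i]) h : gract << z *g g >> xi h = xi (g^-1 * h)%g *~ z.
Proof.
rewrite /gract -(monalg.mmapE (intmul 1) (fun g => xi (g^-1 * h)%g)) monalg.mmapU.
by rewrite mulrzl.
Qed.

Lemma gract_eval n (s : 'I_n -> G) (c : formal n) (xi : G -> R[i]) h :
  gract (eval_formal s c) xi h = \sum_(t <- c) xi ((eval_word s t.2)^-1 * h)%g *~ t.1.
Proof.
rewrite /eval_formal; elim: c => [|t c IH]; first by rewrite !big_nil gract0.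
by rewrite !big_cons gractD gractU IH.
Qed.

Local Notation normc := ComplexField.Normc.normc.

Lemma ell2_zeta g : ell2 R G (zeta R g).
Proof.
rewrite /ell2 /= /summable.
rewrite (_ : esum _ _ = esum [set g]%classic (fun=> 1%E)); last first.
  rewrite [RHS]esum_mkcond; apply: eq_esum => h _; rewrite /zeta. rewrite in_set1.
  case: eqP => _ /=; rewrite expr0n /= addr0 ?expr1n ?sqrtr1 ?expr1n ?sqrtr0 ?expr0n /= ?normr1 ?normr0 //.
by rewrite esum_set1 // ltry.
Qed.

Lemma ell2_finite (f : G -> int) (s : seq G) :
  (forall g, f g != 0 -> g \in s) -> ell2 R G (fun g => (f g)%:~R).
Proof.
move=> hs; rewrite [X in ell2 _ _ X](_ : _ =
  (fun h => \sum_(g <- undup s) (f g)%:~R * zeta R g h)).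
  by apply: ell2_sum => g; apply: ell2Mz; exact: ell2_zeta.
apply/funext => h; case: (boolP (h \in undup s)) => hu.
  rewrite (bigD1_seq h) ?undup_uniq //= /zeta eqxx mulr1 big1 ?addr0 // => g gh.
  by rewrite eq_sym (negPf gh) mulr0.
have -> : f h = 0 by apply: contraNeq hu => /hs; rewrite mem_undup.
rewrite big_seq big1 // => g gu; rewrite /zeta; case: eqP => [e|]; last by rewrite mulr0.
by rewrite e gu in hu.
Qed.

(** Puts square-summability in the form used by [harmonic_eq0]: the finite partial sums are bounded
    by the total norm. *)
Lemma ell2_bound (Q : finType) (xi : Q -> G -> R[i]) : (forall q, ell2 R G (xi q)) ->
  exists C : R, forall s : seq (Q * G), uniq s -> \sum_(p <- s) normc (xi p.1 p.2) ^+ 2 <= C.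
Proof.
move=> hxi; pose E q : \bar R := esum [set: G]%classic (fun g => (normc (xi q g) ^+ 2)%:E).
have Efin q : E q \is a fin_num.
  have := hxi q; rewrite /ell2 /= summableE; congr (_ \is a fin_num).
  by apply: eq_esum => g _; rewrite abse_EFin ger0_norm ?sqr_ge0.
exists (\sum_q fine (E q)) => s us.
rewrite (partition_big (fun p => p.1) xpredT) //=; apply: ler_sum => q _.
rewrite -lee_fin fineK //.
pose t := [seq p.2 | p <- s & p.1 == q].
have ut : uniq t.
  rewrite map_inj_in_uniq ?filter_uniq // => -[q1 g1] [q2 g2].
  by rewrite !mem_filter /= => /andP[/eqP -> _] /andP[/eqP -> _] ->.
apply: esum_ge; exists [set` t]%classic; first by split; [exact: finite_seq|].
rewrite -fsbig_seq // big_map big_filter sumEFin lee_fin le_eqVlt; apply/orP; left; apply/eqP.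
by apply: eq_bigr => -[q' g] /= /eqP ->.
Qed.

End GroupRingAction.

(** * The rows of the matrix and the kernel criterion *)

Section Presentation.

Variables (n : nat) (s : 'I_n -> lamplighter3) (wd : lamplighter3 -> word n).
Hypothesis wdE : forall g, eval_word s (wd g) = g.
Variable C : finType.
Variable vert : option C -> C -> option C -> C -> bool.
Variables (acc : pred C) (adj : rel (option C)) (wgt : pred C).
Local Notation w := (3 * #|(tape_cell C : finType)|)%N.
Local Notation card := (#|{: bool * 'I_w}|).
Local Notation tr N := (transition N vert acc adj wgt).
Local Notation nx N := (bit_transition LeftEnd (tr N)).

Definition unit_word : word n := wd (translation (0, 0, -1)).

Definition pulled_terms (q q' : phase) (a : {ffun bool * 'I_w -> bool}) : formal n :=
  if nx 0%N q a is Some r then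
    if r.1 == q' then
      [seq (- pattern_sign a F, wd (lamp (window 0 F) * translation r.2)%g) |
        F : {ffun bool * 'I_w -> 'Z_2}]
    else [::]
  else [::].

Definition phase_entry (q q' : phase) : formal n :=
  (if q == q' then [:: (2 ^+ card, [::])] else [::]) ++
  flatten [seq pulled_terms q q' a | a : {ffun bool * 'I_w -> bool}].

(** The jump reads no cell, so its row is written without the factor [2 ^+ card] and the sum over
    patterns; [N] then appears in a single word. *)
Definition jump_entry N (q' : phase) : formal n :=
  match q' with
  | Jump => [:: (1, [::])]
  | Restart => [:: (-1, flatten (nseq N unit_word))]
  | _ => [::]
  end.

(* The rows for [Jump] and [Restart] are exchanged so that the only term depending on
   [N] comes last in the encoding. *)
Definition row_phase (i : 'I_6) : phase :=
  nth Jump [:: Compare; Last; Check; First; Restart; Jump] i.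

Definition kernel_mx N : 'M[formal n]_6 :=
  \matrix_(i, j) (if row_phase i == Jump then jump_entry N (phase_decode j)
                  else phase_entry (row_phase i) (phase_decode j)).

Lemma encode_kernel_mx N :
  encode_mx (existT _ 5 (kernel_mx N) : presented_mx n) =
  encode_mx (existT _ 5 (kernel_mx 0) : presented_mx n) ++
    flatten (nseq N [seq inl l | l <- unit_word]).
Proof.
rewrite (@encode_mx_last _ _ (kernel_mx 0) _ (-1) [::] (flatten (nseq N unit_word))).
- by rewrite map_flatten map_nseq.
- by rewrite mxE.
- by rewrite mxE.
move=> i j ne; rewrite !mxE; case: ifP => // iJ.
have im : i = ord_max.
  by apply: val_inj; case: i iJ {ne} => [[|[|[|[|[|[]]]]]]].
have {}ne : j != ord_max by apply: contraNneq ne => ->; rewrite im.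
by case: j ne => [[|[|[|[|[|[]]]]]]].
Qed.

Section Values.
Variable V : zmodType.
Variable xi : phase -> lamplighter3 -> V.

(** Values lie in any abelian group, so that complex vectors, their real and imaginary parts, and
    integer families share one computation. *)
Definition phase_sum (c : phase -> formal n) h : V :=
  \sum_(q' : phase) \sum_(t <- c q') xi q' ((eval_word s t.2)^-1 * h)%g *~ t.1.

Lemma pulled_sum q a h :
  \sum_(q' : phase) \sum_(t <- pulled_terms q q' a) xi q' ((eval_word s t.2)^-1 * h)%g *~ t.1 =
  - (if nx 0%N q a is Some r then
      \sum_F xi r.1 (translation (- r.2) * lamp (window 0 F) * h)%g *~ pattern_sign a F
     else 0).
Proof.
rewrite /pulled_terms; case: (nx 0%N q a) => [r|]; last first.
  by rewrite oppr0 big1 // => q' _; rewrite big_nil.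
rewrite (bigD1 r.1) //= eqxx [X in _ + X]big1 ?addr0; last first.
  by move=> q' ne; rewrite eq_sym (negPf ne) big_nil.
rewrite big_map big_enum /= -sumrN; apply: eq_bigr => F _.
by rewrite wdE invgM lampV -translationN mulrNz.
Qed.

Lemma phase_entry_sum q h :
  phase_sum (phase_entry q) h = xi q h *~ 2 ^+ card - pull (nx 0%N) xi q h.
Proof.
rewrite /phase_sum /phase_entry.
under eq_bigr do rewrite big_cat /=.
rewrite big_split /=; congr (_ + _).
  rewrite (bigD1 q) //= eqxx big_seq1 /= [X in _ + X]big1 ?addr0; last first.
    by move=> q' ne; rewrite eq_sym (negPf ne) big_nil.
  by rewrite /eval_word big_nil invg1 mul1g.
rewrite /pull -sumrN.
under eq_bigr do rewrite big_flatten big_map big_enum /=.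
by rewrite exchange_big /=; apply: eq_bigr => a _; rewrite pulled_sum.
Qed.

Lemma eval_unit_word N : eval_word s (flatten (nseq N unit_word)) = translation (0, 0, - N%:Z).
Proof.
have catE a b : eval_word s (a ++ b) = (eval_word s a * eval_word s b)%g.
  by rewrite /eval_word big_cat.
elim: N => [|N IH] /=; first by rewrite /eval_word big_nil oppr0 translation0.
rewrite catE IH wdE translationD add3.
by congr translation; congr (_, _, _); lia.
Qed.

Lemma opp3 (z : int) : - ((0, 0, - z) : int * int * int) = (0, 0, z).
Proof. by rewrite -[LHS]/(- 0, - 0, - - z) !oppr0 opprK. Qed.

Lemma jump_entry_sum N h :
  phase_sum (jump_entry N) h = xi Jump h - xi Restart (translation (0, 0, N%:Z) * h)%g.
Proof.
rewrite /phase_sum (bigD1 Jump) //= (bigD1 Restart) //= [X in _ + (_ + X)]big1 ?addr0; last first.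
  by case=> //= *; rewrite big_nil.
rewrite !big_seq1 /= {1}/eval_word big_nil invg1 mul1g eval_unit_word -translationN.
by rewrite opp3 mulr1z mulrN1z.
Qed.

(** The projections onto all patterns add up to the identity: summing signs over [a] kills every [F]
    except 0. *)
Lemma pull_jump N h :
  pull (nx N) xi Jump h = xi Restart (translation (0, 0, N%:Z) * h)%g *~ 2 ^+ card.
Proof.
rewrite /pull /=; under eq_bigr => a _ do rewrite !mul0r.
rewrite exchange_big /= (bigD1 (0 : {ffun bool * 'I_w -> 'Z_2})) //= [X in _ + X]big1 ?addr0; last first.
  move=> F F0; rewrite -mulrz_sumr.
  have := pattern_sign_orthogonal2 F 0; rewrite (negPf F0) mulr0n.
  under eq_bigr => a _.
    rewrite [pattern_sign a 0]big1 ?mulr1; last by move=> j _; rewrite ffunE mul0r.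
    over.
  by move=> ->; rewrite mulr0z.
rewrite -mulrz_sumr window0 lamp0 mulg1.
rewrite opp3; congr (_ *~ _).
have := pattern_sign_orthogonal2 (0 : {ffun bool * 'I_w -> 'Z_2}) 0; rewrite eqxx mulr1n => <-.
by apply: eq_bigr => a _; rewrite [pattern_sign a 0]big1 ?mulr1 // => j _; rewrite ffunE mul0r.
Qed.

Lemma pull_phase N q h : q != Jump -> pull (nx N) xi q h = pull (nx 0%N) xi q h.
Proof. by case: q. Qed.

End Values.

Lemma row_phase_surj q : exists i, row_phase i = q.
Proof.
by case: q; [exists (@Ordinal 6 0 isT)|exists (@Ordinal 6 1 isT)|exists (@Ordinal 6 2 isT)
  |exists (@Ordinal 6 3 isT)|exists (@Ordinal 6 5 isT)|exists (@Ordinal 6 4 isT)].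
Qed.

Lemma mxact_kernel_mx (R : realType) N (x : 'I_6 -> lamplighter3 -> R[i]) i h :
  mxact (eval_mx s (kernel_mx N)) x i h =
  phase_sum (fun q => x (phase_code q))
    (if row_phase i == Jump then jump_entry N else phase_entry (row_phase i)) h.
Proof.
rewrite /mxact /phase_sum (reindex phase_code) /=; last first.
  exists phase_decode => q _; first exact: phase_codeK.
  by case: q => [[|[|[|[|[|[]]]]]]] // ?; apply: val_inj.
by apply: eq_bigr => q' _; rewrite !mxE gract_eval phase_codeK; case: ifP.
Qed.

Lemma phase_sum_raddf (V V' : zmodType) (f : {additive V -> V'}) xi c h :
  phase_sum (fun q g => f (xi q g)) c h = f (phase_sum xi c h).
Proof.
rewrite /phase_sum raddf_sum; apply: eq_bigr => q' _; rewrite raddf_sum.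
by apply: eq_bigr => t _; rewrite raddfMz.
Qed.

Lemma kernel_harmonic (V : zmodType) N (xi : phase -> lamplighter3 -> V) :
  (forall i h, phase_sum xi
    (if row_phase i == Jump then jump_entry N else phase_entry (row_phase i)) h = 0) ->
  harmonic (nx N) xi.
Proof.
move=> hxi q h; have [i iq] := row_phase_surj q; have := hxi i h; rewrite iq.
case: eqVneq => [->|qJ].
  by rewrite jump_entry_sum pull_jump => /eqP; rewrite subr_eq0 => /eqP ->.
by rewrite phase_entry_sum pull_phase // => /eqP; rewrite subr_eq0 => /eqP.
Qed.

(** The row of [Jump] requires cancelling [2 ^+ card], which is possible for integer values. *)
Lemma harmonic_kernel N (eta : phase -> lamplighter3 -> int) : harmonic (nx N) eta ->
  forall i h, phase_sum eta (if row_phase i == Jump then jump_entry N else phase_entry (row_phase i)) h = 0.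
Proof.
move=> heta i h; have := heta (row_phase i) h.
case: eqVneq => [->|qJ]; last first.
  by rewrite phase_entry_sum pull_phase // => ->; rewrite subrr.
have p0 : (2 ^+ card)%:~R != 0 :> int by rewrite intr_eq0 expf_neq0.
rewrite jump_entry_sum pull_jump => e; apply/eqP; rewrite subr_eq0; apply/eqP.
by apply: (mulIf p0); rewrite !mulrzr.
Qed.

(** A tableau gives a cycle and so a nonzero finitely supported integer kernel vector. Without
    tableaux there is no cycle on any tapes, and [harmonic_eq0] applies to the real and imaginary
    parts of a kernel vector. *)
Theorem trivial_l2kernel_tableau (R : realType) N :
  trivial_l2kernel R s (existT _ 5 (kernel_mx N) : presented_mx n) <->
  ~ exists H W T, tableau N vert acc adj wgt H W T.
Proof.
split=> [ker [H [W [T /tableau_cycle [m [m0 cyc]]]]]|notab].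
  have [x [u ru]] := bit_cycle LeftEnd (cyc : walks (tr N) _ _ _ = _).
  have inj := bit_injective (g0 := LeftEnd) (@advance_inj C N vert acc adj wgt : forall X u u' t,
    walk (tr N) X u = Some t -> walk (tr N) X u' = Some t -> u = u').
  have [eta [heta [q [h nz]] [l hl]]] := harmonic_cycle m0 ru (inj x).
  pose xi : 'I_6 -> lamplighter3 -> R[i] := fun i g => (eta (phase_decode i) g)%:~R.
  have : l2kernel R (eval_mx s (kernel_mx N)) xi.
    split.
      move=> j; apply: (@ell2_finite R _ (eta (phase_decode j)) [seq p.2 | p <- l]) => g /hl gl.
      by apply/mapP; exists (phase_decode j, g).
    apply/funext => i; apply/funext => g; rewrite mxact_kernel_mx.
    have -> : (fun q => xi (phase_code q)) = (fun q g => (eta q g)%:~R).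
      by apply/funext => q'; apply/funext => g'; rewrite /xi phase_codeK.
    by rewrite (phase_sum_raddf (intmul 1)) (harmonic_kernel heta).
  rewrite ker /= => /(congr1 (fun f => f (phase_code q) h)); rewrite /xi phase_codeK.
  by move/eqP; rewrite intr_eq0 (negPf nz).
have acyc : forall x m v, (0 < m)%N -> vrun (nx N) x m v <> Some v.
  apply: bit_acyclic => X m v m0 cyc; apply: notab.
  exact: cycle_tableau m0 (cyc : advances N vert acc adj wgt X m v = Some v).
apply/seteqP; split => xi /=; last first.
  move=> ->; split => [j|]; first exact: ell2_0.
  apply/funext => i; apply/funext => h; rewrite mxact_kernel_mx /phase_sum.
  by rewrite big1 // => q _; rewrite big1 // => t _; rewrite mul0rz.
case=> hl2 hker.
pose y q := xi (phase_code q).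
have hy i h : phase_sum y (if row_phase i == Jump then jump_entry N else phase_entry (row_phase i)) h = 0.
  by rewrite -mxact_kernel_mx hker.
have [D hD] := ell2_bound (fun q => hl2 (phase_code q) : ell2 R _ (y q)).
have nE (z : R[i]) : ComplexField.Normc.normc z ^+ 2 = complex.Re z ^+ 2 + complex.Im z ^+ 2.
  by case: z => a b /=; rewrite sqr_sqrtr // addr_ge0 ?sqr_ge0.
have re0 : forall q g, complex.Re (y q g) = 0.
  apply: (@harmonic_eq0 _ _ (nx N) R (fun q g => complex.Re (y q g)) D) => //.
    apply: kernel_harmonic => i h.
    by rewrite (phase_sum_raddf (@complex.Re R)) hy raddf0.
  move=> l ul; apply: le_trans (hD l ul); apply: ler_sum => p _.
  by rewrite nE lerDl sqr_ge0.
have im0 : forall q g, complex.Im (y q g) = 0.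
  apply: (@harmonic_eq0 _ _ (nx N) R (fun q g => complex.Im (y q g)) D) => //.
    apply: kernel_harmonic => i h.
    by rewrite (phase_sum_raddf (@complex.Im R)) hy raddf0.
  move=> l ul; apply: le_trans (hD l ul); apply: ler_sum => p _.
  by rewrite nE lerDr sqr_ge0.
apply/funext => j; apply/funext => g.
have <- : phase_code (phase_decode j) = j.
  by case: j => [[|[|[|[|[|[]]]]]]] // ?; apply: val_inj.
by have := re0 (phase_decode j) g; have := im0 (phase_decode j) g; rewrite /y; case: (xi _ g) => a b /= -> ->.
Qed.

End Presentation.

Theorem theorem2 (R : realType) (n : nat) (s : 'I_n -> lamplighter3)
    (s_gen : generates s) :
  ~ TM_decidable (@encode_mx n) (trivial_l2kernel R s).
Proof.
move=> [M hM].
have [wd wdE] := choice s_gen.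
pose u := unit_word wd.
pose wt : seq (symbol n) := [seq inl l | l <- u].
(* The word [u] is nonempty because it represents a nontrivial translation. *)
have wt0 : (0 < size wt)%N.
  rewrite size_map lt0n size_eq0; apply/eqP => u0.
  have := wdE (translation (0, 0, -1)); rewrite -/(unit_word wd) -/u u0 /eval_word big_nil.
  by case.
pose a0 : symbol n := inr Tick.
pose mx N : presented_mx n := existT _ 5 (kernel_mx wd (@vertical _ M wt a0)
  (@accepting _ M wt) (@adjacent _ M wt) (@block_start _ M wt) N).
(* The encoding of [mx N] is [p] followed by [N] blocks; taking for [N] the numeral of [p] makes the
   matrix refer to the run of [M] on its own encoding. *)
pose p := encode_mx (mx 0%N); pose N := numeral p.
have encN : encode_mx (mx N) = p ++ flatten (nseq N wt) by exact: encode_kernel_mx.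
have [b [ans bP]] := hM (mx N); rewrite encN in ans.
have trivP := trivial_l2kernel_tableau wdE (@vertical _ M wt a0)
  (@accepting _ M wt) (@adjacent _ M wt) (@block_start _ M wt) R N.
(* If [M] claims a trivial kernel, its accepting run is a tableau, which contradicts the claim. If
   [M] claims the opposite, a tableau would contain an accepting run on the same input by
   [numeral_inj], so there is none and the kernel is trivial. *)
case: b ans bP => ans [b1 b2].
  apply: (trivP.1 (b1 isT)); apply: tableau_complete => // p0.
  by move: p0; rewrite /p /encode_mx /encode_rows /mx_rows enum_ordSl.
suff : false by [].
apply: b2; apply/trivP => -[H [W [T tab]]].
have [p' [/numeral_inj e ans']] := tableau_sound wt0 tab.
by rewrite e in ans'; have := answers_unique ans ans'.
Qed.
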